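(* Let $p\ge 2$, $q\ge2$ and $t\ge2$ be integers, let $\omega(n)\to\infty$, and let $f(n)=n\,2^{-\omega(n)(\log n)^{1-1/q}}$. If $2t\le pq$ and $\mathbf{Q}\left(t,\frac{n}{\omega(n)}\right)\le\mathbf{Q}\left(p,f(n)\right)$ for all sufficiently large $n$, then $$\overline{\rho\tau}\left(K_{2t},\mathbf{Q}\left(t,\frac{n}{\omega(n)}\right)\right)\le\frac12\left(1-\frac1t\right)\left(1-\frac{1}{q-1}\right).$$
   Context: All graphs are simple and logarithms are base $2$. For integers $t\ge2$, $\mathbf{Q}(t,n)$ is the minimum independence number over all $K_t$-free graphs on $n$ vertices; floor and ceiling signs on non-integer arguments are omitted. For a graph $H$ and a function $h$, $\mathbf{RT}(n,H,h(n))$ denotes the maximum number of edges of an $H$-free graph on $n$ vertices with independence number less than $h(n)$ (taken to be $0$ if no such graph exists), and $\overline{\rho\tau}(H,h)=\limsup_{n\to\infty}\mathbf{RT}(n,H,h(n))/n^2$; here $\mathbf{Q}(t,n/\omega(n))$ stands for the function $n\mapsto\mathbf{Q}(t,n/\omega(n))$. The function $\omega$ is thought of as an arbitrary function tending to infinity slowly. *)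

(* Defs.v *)
From HB Require Import structures.
From mathcomp Require Import all_boot all_order all_algebra.
From mathcomp Require Import all_classical all_reals all_analysis.
Import Order.TTheory GRing.Theory Num.Theory.
Import numFieldNormedType.Exports.

Set Implicit Arguments.
Unset Strict Implicit.
Unset Printing Implicit Defensive.

Local Open Scope ring_scope.

(* A simple graph on the vertex set T is its set of edges, each of them a
   2-element subset of T. *)
Record sgraph (T : finType) := SGraph {
  edges :> {set {set T}};
  _ : [forall e in edges, #|e| == 2%N] }.

HB.instance Definition _ (T : finType) := [isSub for @edges T].
HB.instance Definition _ (T : finType) := [Equality of sgraph T by <:].
HB.instance Definition _ (T : finType) := [Choice of sgraph T by <:].
HB.instance Definition _ (T : finType) := [Countable of sgraph T by <:].
HB.instance Definition _ (T : finType) := [Finite of sgraph T by <:].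

(* [set x; y] is a singleton when x = y, so adj is irreflexive. *)
Definition adj (T : finType) (G : sgraph T) (x y : T) : bool := [set x; y]%SET \in edges G.

(* The image of f need not be an induced subgraph. *)
Definition contains (S T : finType) (H : sgraph S) (G : sgraph T) : bool :=
  [exists f : {ffun S -> T}, injectiveb f &&
    [forall x, forall y, adj H x y ==> adj G (f x) (f y)]].

Definition independent (T : finType) (G : sgraph T) (A : {set T}) : bool :=
  [forall x in A, forall y in A, ~~ adj G x y].

Definition indep_num (T : finType) (G : sgraph T) : nat :=
  \max_(A : {set T} | independent G A) #|A|.

Lemma complete_subproof t :
  [forall e in [set e : {set 'I_t} | #|e| == 2%N]%SET, #|e| == 2%N].
Proof. by apply/forall_inP => e; rewrite inE. Qed.

Definition complete (t : nat) : sgraph 'I_t := SGraph (complete_subproof t).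

(* The default value n does not affect the minimum: indep_num G <= n for every
   graph G on n vertices, and for 2 <= t the edgeless graph is K_t-free. *)
Definition Qmin (t n : nat) : nat :=
  \big[minn/n]_(G : sgraph 'I_n | ~~ contains (complete t) G) indep_num G.

(* An empty maximum is 0. *)
Definition RT (n : nat) (S : finType) (H : sgraph S) (m : nat) : nat :=
  \max_(G : sgraph 'I_n | ~~ contains H G && (indep_num G < m)%N) #|edges G|.

Section Asymptotics.
Variable R : realType.

Definition rho_tau_sup (S : finType) (H : sgraph S) (h : nat -> nat) : \bar R :=
  limn_esup (fun n => ((RT n H (h n))%:R / n%:R ^+ 2)%:E).

Definition log2 (x : R) : R := ln x / ln 2.

Definition f_bound (q : nat) (omega : nat -> R) (n : nat) : R :=
  n%:R * 2 `^ (- (omega n * log2 n%:R `^ (1 - q%:R^-1))).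

(* Non-integer numbers of vertices are rounded down (and negative ones, which
   can only occur for small n, are replaced by 0). *)
Definition Qreal (t : nat) (x : R) : nat := Qmin t (Num.truncn x).

End Asymptotics.

(* Main.v *)
(* Let beta = 1 - 1/t and N = n. If a linear-size set Y has many vertices sending
   more than (beta + eps)|Y| edges to it, then a K_t among those vertices has
   linearly many common neighbours in Y, hence a second K_t completes a K_2t.
   So a K_2t-free G has e(X, Y) <= beta |X||Y| + o(N^2) for all X and Y. By
   Frieze-Kannan weak regularity, G is close in cut norm to a step function with
   values at most beta + o(1); if 2 e(G) >= (beta (1 - 1/(q-1)) + eps) N^2, then
   the support of the step function has density above 1 - 1/(q-1), so by Turan
   supersaturation and the counting lemma G contains c N^q copies of K_q.
   Dependent random choice now turns these copies, one vertex class at a time,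
   into q cliques K_p completely joined to each other: if a p-set of vertices is
   chosen among the common neighbours of s random (q-1)-tuples, the density of
   the common link drops from 2^-O((log n)^(i/q)) to 2^-O((log n)^((i+1)/q)),
   and all the sets in which a K_p is sought have more than f(n) vertices.
   The resulting K_pq contains K_2t. *)
Require Import Defs.
From mathcomp Require Import all_boot all_order all_algebra.
From mathcomp Require Import ring lra zify.
Import Order.TTheory GRing.Theory Num.Theory.

Set Implicit Arguments.
Unset Strict Implicit.
Unset Printing Implicit Defensive.

Local Open Scope ring_scope.

(** * Weak regularity *)

Section CellAverage.
Variables (R : realFieldType) (Z I : finType).

(** The conditional expectation of [h] given the partition of [Z] into the fibres of [c]. The
    denominator counts the cell of [z], which contains [z]. *)
Definition cell_avg (c : Z -> I) (h : Z -> R) (z : Z) : R :=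
  (\sum_(y | c y == c z) h y) / (\sum_(y | c y == c z) 1).

(** Averaging preserves the sum of [h] over each fibre of [c], and [k \o c] is constant there. *)
Lemma sum_cell_avg c h (k : I -> R) :
  \sum_z cell_avg c h z * k (c z) = \sum_z h z * k (c z).
Proof.
rewrite (partition_big c predT) //= [RHS](partition_big c predT) //=.
apply: eq_bigr => i _.
have E z : c z == i -> cell_avg c h z * k (c z) =
    (\sum_(y | c y == i) h y) / (\sum_(y | c y == i) 1) * k i.
  by move=> /eqP <-.
rewrite (eq_bigr _ E).
rewrite [RHS](eq_bigr (fun z => h z * k i)); last by move=> z /eqP ->.
rewrite -[RHS]mulr_suml.
(* An empty fibre would make the quotient a division by zero; there both sums are empty. *)
have [e0|ne0] := eqVneq (\sum_(y | c y == i) (1 : R)) 0.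
  have nz : forall z, c z == i = false.
    move=> z; apply/negbTE/negP => cz.
    have : 0 < \sum_(y | c y == i) (1 : R).
      rewrite (bigD1 z) //=; apply: ltr_wpDr => //.
      exact: sumr_ge0.
    by rewrite e0 ltxx.
  by rewrite !big_pred0 // mul0r.
rewrite -[LHS]mulr_suml; congr (_ * _).
under eq_bigr => z _ do rewrite -[_ / _]mulr1.
by rewrite -mulr_sumr divfK.
Qed.

Lemma cell_avg_ge0 c h z : (forall y, 0 <= h y) -> 0 <= cell_avg c h z.
Proof. by move=> h0; rewrite divr_ge0 ?sumr_ge0. Qed.

Lemma cell_size_gt0 (c : Z -> I) z : 0 < \sum_(y | c y == c z) (1 : R).
Proof. by rewrite (bigD1 z) //= ltr_wpDr // sumr_ge0. Qed.

Lemma cell_avg_le c h z b :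
  \sum_(y | c y == c z) h y <= b * (\sum_(y | c y == c z) 1) ->
  cell_avg c h z <= b.
Proof. by move=> hb; rewrite ler_pdivrMr // cell_size_gt0. Qed.

Lemma cell_avg_le1 c h z : (forall y, h y <= 1) -> cell_avg c h z <= 1.
Proof. by move=> h1; apply: cell_avg_le; rewrite mul1r ler_sum. Qed.

Definition energy c h := \sum_z cell_avg c h z ^+ 2.

End CellAverage.

(** Pythagoras: since [c'] refines [c], the coarse average is constant on the cells of [c'], so the
    cross term equals the energy of [c]. *)
Lemma energy_refine (R : realFieldType) (Z I : finType) (c c' : Z -> I) r (h : Z -> R) :
  c =1 r \o c' ->
  \sum_z (cell_avg c' h z - cell_avg c h z) ^+ 2 = energy c' h - energy c h.
Proof.
move=> cr.
pose k i : R := (\sum_(y | c y == i) h y) / (\sum_(y | c y == i) 1).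
have kE z : cell_avg c h z = k (c z) by [].
have E1 : \sum_z cell_avg c' h z * cell_avg c h z = \sum_z h z * cell_avg c h z.
  have E z : cell_avg c h z = (k \o r) (c' z) by rewrite kE cr.
  under eq_bigr => z _ do rewrite E.
  under [RHS]eq_bigr => z _ do rewrite E.
  exact: sum_cell_avg.
have E2 : \sum_z cell_avg c h z ^+ 2 = \sum_z h z * cell_avg c h z.
  by rewrite -(sum_cell_avg c h k); apply: eq_bigr => z _; rewrite expr2.
rewrite /energy E2.
have -> : \sum_z (cell_avg c' h z - cell_avg c h z) ^+ 2 =
  energy c' h - \sum_z cell_avg c' h z * cell_avg c h z *+ 2 + energy c h.
  rewrite /energy -sumrB -big_split /=; apply: eq_bigr => z _; ring.
rewrite /energy E2 sumrMnl E1; ring.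
Qed.

(** Cauchy-Schwarz without square roots: termwise, [|d| <= (d ^+ 2 / g + g) / 2]. *)
Lemma sum_le_of_sq (R : realFieldType) (Z : finType) (d b : Z -> R) (g : R) :
  0 < g -> (forall z, `|b z| <= 1) ->
  \sum_z d z ^+ 2 <= g ^+ 2 * #|Z|%:R -> `|\sum_z d z * b z| <= g * #|Z|%:R.
Proof.
move=> g0 b1 hd.
have step z : `|d z * b z| <= (d z ^+ 2 / g + g) / 2.
  rewrite normrM; apply: (@le_trans _ _ `|d z|).
    by rewrite -[leRHS]mulr1 ler_wpM2l.
  rewrite -[d z ^+ 2]real_normK ?num_real //; move: `|d z| => a.
  rewrite -subr_ge0.
  have -> : (a ^+ 2 / g + g) / 2 - a = (a - g) ^+ 2 / (2 * g).
    by field; rewrite lt0r_neq0.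
  by rewrite divr_ge0 ?sqr_ge0 // mulr_ge0 // ltW.
apply: (le_trans (ler_norm_sum _ _ _)).
apply: (le_trans (ler_sum _ (fun z _ => step z))).
rewrite -mulr_suml big_split /= -mulr_suml sumr_const.
have : (\sum_i d i ^+ 2) / g <= g * #|Z|%:R by rewrite ler_pdivrMr //; nra.
have -> : g *+ #|{: Z}| = g * #|Z|%:R by rewrite mulr_natr.
lra.
Qed.

Section WeakRegularity.
Variables (R : realFieldType) (V : finType).

(** The fibres of [signature L] are the atoms of the set algebra generated by [L]; those of
    [signature2 L] are the products of two atoms. *)
Definition signature (L : {set {set V}}) (x : V) : {set {set V}} :=
  [set X in L | x \in X].

Definition signature2 L (z : V * V) := (signature L z.1, signature L z.2).

Lemma signature_subset (L L' : {set {set V}}) x :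
  L \subset L' -> signature L x = signature L' x :&: L.
Proof.
move=> /subsetP sL; apply/setP => X; rewrite !inE.
by case: (boolP (X \in L)) => [/sL ->|_]; rewrite ?andbT ?andbF.
Qed.

(** After [X] and [Y] join the family, [setX X Y] is a union of cells. The discrepancy is then the
    sum over it of the difference of the two averages, and [energy_refine] identifies the squared
    norm of that difference with the energy gain. *)
Lemma energy_increment (g : R) (A : V * V -> R) (L : {set {set V}}) (X Y : {set V}) :
  0 < g ->
  `|\sum_(z in setX X Y) (A z - cell_avg (signature2 L) A z)| > g * #|{: V * V}|%:R ->
  energy (signature2 L) A + g ^+ 2 * #|{: V * V}|%:R <
    energy (signature2 (X |: (Y |: L))) A.
Proof.
move=> g0; apply: contraTT; rewrite -!leNgt => hen.
set L' := X |: (Y |: L).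
have sL : L \subset L' by apply/subsetP => Z; rewrite !inE => ->; rewrite !orbT.
pose r (ij : {set {set V}} * {set {set V}}) := (ij.1 :&: L, ij.2 :&: L).
have cr : signature2 L =1 r \o signature2 L'.
  by move=> z; rewrite /signature2 /r /= -!(signature_subset _ sL).
have := energy_refine A cr => hd.
pose k (ij : {set {set V}} * {set {set V}}) : R := ((X \in ij.1) && (Y \in ij.2))%:R.
have kE z : (z \in setX X Y)%:R = k (signature2 L' z).
  by rewrite /k !inE !eqxx /= orbT.
have -> : \sum_(z in setX X Y) (A z - cell_avg (signature2 L) A z) =
   \sum_z (cell_avg (signature2 L') A z - cell_avg (signature2 L) A z)
      * (z \in setX X Y)%:R.
  rewrite big_mkcond /=.
  under [RHS]eq_bigr => z _ do rewrite mulrBl kE.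
  rewrite sumrB (sum_cell_avg (signature2 L') A k) -sumrB.
  apply: eq_bigr => z _; rewrite -kE -mulrBl.
  by case: (z \in _); rewrite ?mulr1 ?mulr0.
apply: sum_le_of_sq => //.
  by move=> z; case: (z \in _); rewrite ?normr1 ?normr0.
by rewrite hd lerBlDl.
Qed.

(* The energy is at most |V|^2 and grows by a definite amount as long as the
   conclusion fails, which can thus happen at most j times. *)
Lemma weak_regularity (g : R) (j : nat) (A : V * V -> R) :
  0 < g -> 1 < g ^+ 2 * j%:R -> (forall z, 0 <= A z <= 1) ->
  exists2 L : {set {set V}}, (#|L| <= 2 * j)%N &
    forall X Y : {set V},
      `|\sum_(z in setX X Y) (A z - cell_avg (signature2 L) A z)|
        <= g * #|{: V * V}|%:R.
Proof.
move=> g0 gj A01; set M : R := #|{: V * V}|%:R.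
have [M0|M0] := eqVneq M 0.
  exists set0; first by rewrite cards0.
  move=> X Y; rewrite big1 ?normr0 ?M0 ?mulr0 // => z _.
  have /card0_eq /(_ z) : #|{: V * V}| = 0%N.
    by apply/eqP; rewrite -(pnatr_eq0 R) -/M M0.
  by rewrite inE.
have Mgt0 : 0 < M by rewrite lt_def M0 ler0n.
pose reg (L : {set {set V}}) := [forall X : {set V}, forall Y : {set V},
  `|\sum_(z in setX X Y) (A z - cell_avg (signature2 L) A z)| <= g * M].
have regP L : reg L -> forall X Y : {set V},
   `|\sum_(z in setX X Y) (A z - cell_avg (signature2 L) A z)| <= g * M.
  by move=> /forallP h X Y; move/forallP: (h X).
have step i : (exists2 L : {set {set V}}, (#|L| <= 2 * i)%N & reg L) \/
    (exists2 L : {set {set V}}, (#|L| <= 2 * i)%N & i%:R * (g ^+ 2 * M) <= energy (signature2 L) A).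
  elim: i => [|i [[L cL rL]|[L cL eL]]].
  - right; exists set0; first by rewrite cards0.
    by rewrite mul0r; apply: sumr_ge0 => z _; exact: sqr_ge0.
  - by left; exists L => //; apply: leq_trans cL _; rewrite leq_mul2l leqnSn.
  have [rL|] := boolP (reg L).
    by left; exists L => //; apply: leq_trans cL _; rewrite leq_mul2l leqnSn.
  move=> /forallPn [X /forallPn [Y]]; rewrite -ltNge => hXY.
  right; exists (X |: (Y |: L)).
    rewrite !cardsU1 mulnS addnA leq_add //.
    by do 2 case: (_ \notin _).
  rewrite -natr1 mulrDl mul1r; apply: ltW.
  apply: le_lt_trans (energy_increment g0 hXY).
  by rewrite lerD2r.
have [[L cL /regP rL]|[L cL]] := step j; first by exists L.
have : energy (signature2 L) A <= M.
  rewrite /M -sum1_card natr_sum; apply: ler_sum => z _.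
  have a0 : 0 <= cell_avg (signature2 L) A z.
    by apply: cell_avg_ge0 => y; case/andP: (A01 y).
  have a1 : cell_avg (signature2 L) A z <= 1.
    by apply: cell_avg_le1 => y; case/andP: (A01 y).
  by rewrite exprn_ile1.
move=> h1 h2; exfalso.
have := le_trans h2 h1; apply/negP; rewrite -ltNge mulrCA mulrA ltr_pMl //.
Qed.
End WeakRegularity.

(** * Counting lemma *)

Section Counting.
Variables (R : realFieldType) (V : finType) (q : nat).
Implicit Types (f : {ffun 'I_q -> V}) (D : V * V -> R).

Definition upd f a x : {ffun 'I_q -> V} := [ffun i => if i == a then x else f i].

(** Resampling one coordinate: exchanging [f a] with [x] is an involution on the pairs [(f, x)]. *)
Lemma sum_upd (F : {ffun 'I_q -> V} -> R) a :
  \sum_f \sum_x F (upd f a x) = #|V|%:R * \sum_f F f.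
Proof.
pose sw (u : {ffun 'I_q -> V} * V) := (upd u.1 a u.2, u.1 a).
have swK : involutive sw.
  move=> [f x]; rewrite /sw /=; congr pair; last by rewrite ffunE eqxx.
  by apply/ffunP => i; rewrite !ffunE; case: eqP => // ->.
rewrite pair_big /= (reindex_inj (inv_inj swK)) /=.
under eq_bigr => u _.
  have -> : upd (upd u.1 a u.2) a (u.1 a) = u.1.
    by have := swK u; case: (u) => f x /=; rewrite /sw /= => -[->].
  over.
rewrite -(pair_big predT predT (fun f _ => F f)) /= mulr_sumr.
by apply: eq_bigr => f _; rewrite sumr_const mulr_natl.
Qed.

(** A linear form in weights from [0, 1] is largest at an indicator function. Applied to each
    variable in turn, this extends a cut norm bound from sets to weights. *)
Lemma weighted_sum_le (h u : V -> R) : (forall x, 0 <= u x <= 1) ->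
  exists X : {set V}, \sum_x h x * u x <= \sum_(x in X) h x.
Proof.
move=> u01; exists [set x | 0 <= h x]%SET.
rewrite [leRHS]big_mkcond; apply: ler_sum => x _; rewrite inE.
have /andP[u0 u1] := u01 x.
by case: (lerP 0 (h x)) => hx; [rewrite ler_piMr | rewrite mulr_le0_ge0 // ltW].
Qed.

Lemma cut_weighted_le D (c : R) (u v : V -> R) :
  (forall X Y : {set V}, \sum_(z in setX X Y) D z <= c) ->
  (forall x, 0 <= u x <= 1) -> (forall x, 0 <= v x <= 1) ->
  \sum_x \sum_y D (x, y) * (u x * v y) <= c.
Proof.
move=> hD u01 v01.
have [X hX] := weighted_sum_le (fun x => \sum_y D (x, y) * v y) u01.
have [Y hY] := weighted_sum_le (fun y => \sum_(x in X) D (x, y)) v01.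
apply: le_trans (hD X Y).
have -> : \sum_x \sum_y D (x, y) * (u x * v y) =
    \sum_x (\sum_y D (x, y) * v y) * u x.
  by apply: eq_bigr => x _; rewrite mulr_suml; apply: eq_bigr => y _; ring.
apply: (le_trans hX).
rewrite exchange_big /=.
under eq_bigr => y _ do rewrite -mulr_suml.
apply: (le_trans hY); rewrite exchange_big /= pair_big_dep /=.
rewrite le_eqVlt; apply/orP; left; apply/eqP.
by apply: eq_big => [[x y]|[x y] //]; rewrite inE.
Qed.

Lemma cut_weighted D (c : R) (u v : V -> R) :
  (forall X Y : {set V}, `|\sum_(z in setX X Y) D z| <= c) ->
  (forall x, 0 <= u x <= 1) -> (forall x, 0 <= v x <= 1) ->
  `|\sum_x \sum_y D (x, y) * (u x * v y)| <= c.
Proof.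
move=> hD u01 v01; rewrite ler_norml; apply/andP; split; last first.
  by apply: cut_weighted_le => // X Y; apply: le_trans (ler_norm _) (hD X Y).
rewrite lerNl -sumrN.
under eq_bigr => x _.
  rewrite -sumrN; under eq_bigr => y _ do rewrite -mulNr.
  over.
apply: (@cut_weighted_le (fun z => - D z)) => // X Y.
by rewrite sumrN; apply: le_trans (hD X Y); rewrite -normrN ler_norm.
Qed.

Definition edge_pair := [pred e : 'I_q * 'I_q | (e.1 < e.2)%N].

Lemma prod01 (I : finType) (P : pred I) (F : I -> R) :
  (forall i, 0 <= F i <= 1) -> 0 <= \prod_(i | P i) F i <= 1.
Proof.
move=> F01; rewrite prodr_ge0 => [|i _]; last by case/andP: (F01 i).
by rewrite prodr_ile1.
Qed.

(** With all coordinates of [f] but those at the ends of [e0] fixed, every other factor depends on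
    at most one of the two free ones. The product thus splits as [u x * v y] and [cut_weighted]
    applies. The factor [#|V|%:R ^+ 2] comes from resampling both ends. *)
Lemma replace_edge D (c : R) (W : 'I_q * 'I_q -> V * V -> R) (e0 : 'I_q * 'I_q) :
  edge_pair e0 -> (forall e z, 0 <= W e z <= 1) ->
  (forall X Y : {set V}, `|\sum_(z in setX X Y) D z| <= c) ->
  #|V|%:R ^+ 2 * `|\sum_(f : {ffun 'I_q -> V}) D (f e0.1, f e0.2) *
     \prod_(e | edge_pair e && (e != e0)) W e (f e.1, f e.2)| <= c * #|V|%:R ^+ q.
Proof.
case: e0 => a b /= ab W01 hD.
pose F (f : {ffun 'I_q -> V}) := D (f a, f b) *
  \prod_(e | edge_pair e && (e != (a, b))) W e (f e.1, f e.2).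
rewrite -/(\sum_(f : {ffun 'I_q -> V}) F f).
have nab : (a == b) = false by apply/negbTE; rewrite -val_eqE neq_ltn ab.
have nba : (b == a) = false by rewrite eq_sym.
rewrite -[#|V|%:R ^+ 2]ger0_norm ?sqr_ge0 // -normrM expr2 -mulrA.
rewrite -(sum_upd F b) -(sum_upd (fun f => \sum_x F (upd f b x)) a).
have -> : c * #|V|%:R ^+ q = \sum_(f : {ffun 'I_q -> V}) c.
  by rewrite sumr_const card_ffun card_ord -natrX mulr_natr.
apply: le_trans (ler_norm_sum _ _ _) _; apply: ler_sum => f _.
pose inc (e : 'I_q * 'I_q) := (e.1 == b) || (e.2 == b).
pose G (g : {ffun 'I_q -> V}) e := W e (g e.1, g e.2).
pose u x := \prod_(e | edge_pair e && (e != (a, b)) && ~~ inc e) G (upd f a x) e.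
pose v y := \prod_(e | edge_pair e && (e != (a, b)) && inc e) G (upd f b y) e.
have E x y : F (upd (upd f a x) b y) = D (x, y) * (u x * v y).
  rewrite /F !ffunE !eqxx nab; congr (_ * _).
  rewrite (bigID inc) /= mulrC; congr (_ * _); apply: eq_bigr => -[i j] /=.
    rewrite /inc /= negb_or => /andP[_ /andP[ib jb]].
    by rewrite /G !ffunE /= (negbTE ib) (negbTE jb).
  rewrite /inc /= => /andP[/andP[ij ne]] hb.
  (* A pair [i < j] that meets [b] and differs from [(a, b)] avoids [a], because [(b, a)] is
     excluded by [a < b]. *)
  suff [ia ja] : i != a /\ j != a.
    by rewrite /G !ffunE /= (negbTE ia) (negbTE ja).
  case/orP: hb => /eqP hb; subst.
    split; first by rewrite nba.
    by apply: contraTneq ij => ->; rewrite -leqNgt ltnW.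
  by split; [move: ne; rewrite xpair_eqE eqxx andbT | rewrite nba].
under eq_bigr => x _ do under eq_bigr => y _ do rewrite E.
by apply: cut_weighted => // x; apply: prod01 => e; apply: W01.
Qed.

Definition hom_density_sum (A : V * V -> R) :=
  \sum_(f : {ffun 'I_q -> V}) \prod_(e | edge_pair e) A (f e.1, f e.2).

(* The edges of K_q are switched from A to B one at a time. *)
Lemma counting_lemma (A B : V * V -> R) (c : R) :
  (forall z, 0 <= A z <= 1) -> (forall z, 0 <= B z <= 1) ->
  (forall X Y : {set V}, `|\sum_(z in setX X Y) (A z - B z)| <= c) ->
  #|V|%:R ^+ 2 * `|hom_density_sum A - hom_density_sum B|
    <= (q ^ 2)%:R * (c * #|V|%:R ^+ q).
Proof.
move=> A01 B01 hAB.
(* Pairs listed in [s] carry [A], the others [B]. Repeated entries and entries that are not edges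
   leave [h] unchanged. *)
pose W (s : seq ('I_q * 'I_q)) e z := if e \in s then A z else B z.
have W01 s e z : 0 <= W s e z <= 1 by rewrite /W; case: ifP.
pose h s := \sum_(f : {ffun 'I_q -> V}) \prod_(e | edge_pair e) W s e (f e.1, f e.2).
have c0 : 0 <= c by exact: le_trans (normr_ge0 _) (hAB set0 set0).
have cV0 : 0 <= c * #|V|%:R ^+ q by rewrite mulr_ge0 // exprn_ge0.
have hs s : #|V|%:R ^+ 2 * `|h s - h [::]| <= (size s)%:R * (c * #|V|%:R ^+ q).
  elim: s => [|e0 s IH]; first by rewrite subrr normr0 mulr0 mul0r.
  have -> : h (e0 :: s) - h [::] = (h (e0 :: s) - h s) + (h s - h [::]) by ring.
  apply: (@le_trans _ _ (#|V|%:R ^+ 2 * (`|h (e0 :: s) - h s| + `|h s - h [::]|))).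
    by rewrite ler_wpM2l ?sqr_ge0 // ler_normD.
  rewrite mulrDr /= -natr1 mulrDl mul1r addrC lerD //.
  have [in0|nin] := boolP (e0 \in s).
    have -> : h (e0 :: s) = h s.
      apply: eq_bigr => f _; apply: eq_bigr => e _; rewrite /W inE.
      by case: eqP => // ->; rewrite in0.
    by rewrite subrr normr0 mulr0.
  have [p0|np0] := boolP (edge_pair e0); last first.
    have -> : h (e0 :: s) = h s.
      apply: eq_bigr => f _; apply: eq_bigr => e pe; rewrite /W inE.
      by case: eqP => // ee; rewrite -ee pe in np0.
    by rewrite subrr normr0 mulr0.
  have -> : h (e0 :: s) - h s = \sum_(f : {ffun 'I_q -> V}) (A (f e0.1, f e0.2) - B (f e0.1, f e0.2)) *
     \prod_(e | edge_pair e && (e != e0)) W s e (f e.1, f e.2).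
    rewrite -sumrB; apply: eq_bigr => f _.
    rewrite (bigD1 e0) //= [X in _ - X](bigD1 e0) //= mulrBl.
    congr (_ * _ - _ * _).
    - by rewrite /W inE eqxx.
    - by apply: eq_bigr => e /andP[_ ne]; rewrite /W inE (negbTE ne).
    - by rewrite /W (negbTE nin).
  exact: (@replace_edge (fun z => A z - B z)).
(* Listing all ordered pairs makes the number of steps [q ^ 2]. *)
have := hs (enum {: 'I_q * 'I_q}).
rewrite -cardE card_prod card_ord mulnn; congr (is_true (_ * `|_ - _| <= _)).
  by apply: eq_bigr => f _; apply: eq_bigr => e _; rewrite /W mem_enum inE.
Qed.
End Counting.

(** * Turan supersaturation *)

Section CliqueTuples.
Variables (V : finType).

(** Nested pairs, so that splitting off the first vertex is a projection and sets of tuples can be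
    handled by induction on the length. *)
Fixpoint tup (k : nat) : finType := if k is k'.+1 then (V * tup k')%type else unit.

Definition nbhd (e : rel V) x : {set V} := [set y | e x y].

Fixpoint clique_tuple (e : rel V) k (B : {set V}) : tup k -> bool :=
  if k is k'.+1 return tup k -> bool then
    fun w => (w.1 \in B) && clique_tuple e (B :&: nbhd e w.1) w.2
  else fun=> true.

Lemma card_tup k : #|{: tup k}| = (#|V| ^ k)%N.
Proof.
elim: k => [|k IH]; first by rewrite expn0 card_unit.
by rewrite /= card_prod IH expnS.
Qed.

Definition num_clique_tuples (e : rel V) k B := #|[set w : tup k | clique_tuple e B w]|.

Lemma clique_tuple_subset e k (B B' : {set V}) (w : tup k) :
  B \subset B' -> clique_tuple e B w -> clique_tuple e B' w.
Proof.
elim: k B B' w => //= k IH B B' [x w] BB /= /andP[xB hw].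
by rewrite (subsetP BB) //=; apply: IH hw; apply: setSI.
Qed.

Lemma num_clique_tuples_subset e k (B B' : {set V}) :
  B \subset B' -> (num_clique_tuples e k B <= num_clique_tuples e k B')%N.
Proof.
move=> BB; apply: subset_leq_card; apply/subsetP => w; rewrite !inE.
exact: clique_tuple_subset.
Qed.

Lemma num_clique_tuplesS e k B :
  num_clique_tuples e k.+1 B = (\sum_(x in B) num_clique_tuples e k (B :&: nbhd e x))%N.
Proof.
rewrite /num_clique_tuples -sum1_card.
under [RHS]eq_bigr => x _ do rewrite -sum1_card.
rewrite pair_big_dep /=; apply: eq_bigl => -[x w]; by rewrite !inE.
Qed.

Variable R : realFieldType.

(** The 0/1 indicator that [f] lists a clique inside [B]; it links the finite functions of the
    counting lemma to the nested tuples. *)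
Definition hom_in (e : rel V) k (B : {set V}) (f : {ffun 'I_k -> V}) : R :=
  (\prod_i (f i \in B)%:R) * \prod_(ij | @edge_pair k ij) (e (f ij.1) (f ij.2))%:R.

Definition fcons k x (f : {ffun 'I_k -> V}) : {ffun 'I_k.+1 -> V} :=
  [ffun i => if unlift ord0 i is Some j then f j else x].

Lemma fcons0 k x (f : {ffun 'I_k -> V}) : fcons x f ord0 = x.
Proof. by rewrite ffunE unlift_none. Qed.

Lemma fconsS k x (f : {ffun 'I_k -> V}) i : fcons x f (lift ord0 i) = f i.
Proof. by rewrite ffunE liftK. Qed.

Lemma hom_in_fcons e k B x (f : {ffun 'I_k -> V}) :
  hom_in e B (fcons x f) = (x \in B)%:R * hom_in e (B :&: nbhd e x) f.
Proof.
rewrite /hom_in big_ord_recl fcons0 -mulrA; congr (_ * _).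
have E m (F : 'I_m * 'I_m -> R) : \prod_(ij | @edge_pair m ij) F ij
     = \prod_(i < m) \prod_(j < m | (i < j)%N) F (i, j).
  by rewrite pair_big_dep /=; apply: eq_big => [[i j]|[i j]].
rewrite !E [X in _ * X]big_ord_recl /= mulrA.
rewrite [X in _ * X * _]big_mkcond /= big_ord_recl /= mul1r.
congr (_ * _).
  rewrite -big_split /=; apply: eq_bigr => i _.
  by rewrite fconsS fcons0 !inE -natrM mulnb.
apply: eq_bigr => i _.
rewrite big_mkcond big_ord_recl /= mul1r [RHS]big_mkcond.
by apply: eq_bigr => j _; rewrite !fconsS.
Qed.

Lemma sum_hom_in e k B : \sum_(f : {ffun 'I_k -> V}) hom_in e B f = (num_clique_tuples e k B)%:R.
Proof.
elim: k B => [|k IH] B.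
  have -> : num_clique_tuples e 0 B = 1%N.
    rewrite /num_clique_tuples -[RHS]card_unit; apply: eq_card => w.
    by rewrite !inE.
  rewrite (eq_bigr (fun=> 1)); last first.
    move=> f _; rewrite /hom_in big_ord0 mul1r big_pred0 // => -[[]] //.
  by rewrite sumr_const card_ffun card_ord expn0.
rewrite num_clique_tuplesS natr_sum [RHS]big_mkcond /=.
pose ff (u : V * {ffun 'I_k -> V}) := fcons u.1 u.2.
pose gg (f : {ffun 'I_k.+1 -> V}) := (f ord0, [ffun i => f (lift ord0 i)]).
have fK : cancel ff gg.
  move=> [x f]; rewrite /ff /gg fcons0; congr pair.
  by apply/ffunP => i; rewrite ffunE fconsS.
have gK : cancel gg ff.
  move=> f; apply/ffunP => i; rewrite /ff /gg ffunE /=.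
  by case: unliftP => [j|] ->; rewrite ?ffunE.
rewrite (reindex ff); last by exists gg => u _; rewrite ?fK ?gK.
rewrite -(pair_big predT predT (fun x f => hom_in e B (fcons x f))) /=.
apply: eq_bigr => x _.
under eq_bigr => f _ do rewrite hom_in_fcons.
rewrite -mulr_sumr IH; by case: ifP; rewrite ?mul1r ?mul0r.
Qed.

Lemma hom_density_sum_indicator (e : rel V) k :
  hom_density_sum k (fun z => (e z.1 z.2)%:R : R) = (num_clique_tuples e k setT)%:R.
Proof.
rewrite -sum_hom_in; apply: eq_bigr => f _; rewrite /hom_in.
by rewrite [X in X * _]big1 ?mul1r // => i _; rewrite inE.
Qed.

(** Ordered pairs are counted, hence twice the number of edges when [e] is symmetric and
    irreflexive. *)
Definition edges_in (e : rel V) (U : {set V}) : nat :=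
  (\sum_(x in U) #|U :&: nbhd e x|)%N.

(** Deleting [x] loses its row and its column of the adjacency matrix; a loop at [x] would be
    counted in both, hence only an inequality. *)
Lemma edges_in_setD1 e (U : {set V}) x : symmetric e -> x \in U ->
  (edges_in e U <= edges_in e (U :\ x) + 2 * #|U :&: nbhd e x|)%N.
Proof.
move=> se xU; rewrite /edges_in (bigD1 x) //= mul2n -addnn addnA [X in (_ <= X)%N]addnC leq_add2l.
have -> : (\sum_(i in U | i != x) #|U :&: nbhd e i| =
    \sum_(i in U :\ x) (#|(U :\ x) :&: nbhd e i| + (e i x)))%N.
  apply: eq_big => [i|i /andP[iU ix]]; first by rewrite !inE andbC.
  rewrite (cardsD1 x) !inE xU addnC; congr (_ + _)%N.
  by apply: eq_card => y; rewrite !inE andbA.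
rewrite big_split leq_add2l -sum1_card big_mkcond [X in (_ <= X)%N]big_mkcond.
apply: leq_sum => i _; rewrite !inE se.
by case: (i != x); case: (i \in U); case: (e x i).
Qed.

(* A vertex set maximizing edges_in U - lam * #|U| * (#|U| + 1) induces a
   subgraph of large minimum degree. *)
Lemma exists_min_degree (e : rel V) (lam eps : R) :
  symmetric e -> 0 <= lam <= 1 -> 0 < eps <= 1 -> 2 / eps <= #|V|%:R ->
  (lam + eps) * #|V|%:R ^+ 2 <= (edges_in e setT)%:R ->
  exists2 U : {set V}, eps / 2 * #|V|%:R <= #|U|%:R &
    forall x, x \in U -> lam * #|U|%:R <= #|U :&: nbhd e x|%:R.
Proof.
move=> se /andP[lam0 lam1] /andP[e0 e1] Vbig hE.
pose Phi (U : {set V}) : R := (edges_in e U)%:R - lam * (#|U|%:R * (#|U|%:R + 1)).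
have [U _ hU] : exists2 U, U \in setT & forall U', Phi U' <= Phi U.
  have [U _ hU] := Order.TotalTheory.arg_maxP Phi (erefl (predT (setT : {set V}))).
  by exists U; rewrite ?inE // => U'; apply: hU.
have N0 : (0 : R) <= #|V|%:R by [].
have U0 : (0 : R) <= #|U|%:R by [].
have UV : (#|U|%:R : R) <= #|V|%:R by rewrite ler_nat max_card.
exists U.
  have := hU setT; rewrite /Phi cardsT => h.
  have hUU : (edges_in e U)%:R <= (#|U|%:R ^+ 2 : R).
    rewrite -natrX ler_nat -mulnn -sum_nat_const; apply: leq_sum => x _.
    by rewrite subset_leq_card // subsetIl.
  have eV : 2 <= #|V|%:R * eps by rewrite -ler_pdivrMr.
  have V0 : 0 < (#|V|%:R : R) by apply: lt_le_trans Vbig; rewrite divr_gt0.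
  (* Maximality against the whole vertex set gives [eps * N ^+ 2 - lam * N <= #|U| ^+ 2], with [N]
     the number of vertices; [N >= 2 / eps] absorbs the linear term. *)
  have Q : eps / 2 * #|V|%:R ^+ 2 <= #|U|%:R ^+ 2 by nra.
  have : eps / 2 * #|V|%:R * #|V|%:R <= #|U|%:R * #|V|%:R by nra.
  by rewrite ler_pM2r.
(* Deleting [x] lowers [#|U| * (#|U| + 1)] by exactly [2 * #|U|] and [edges_in] by at most twice the
   degree of [x], so maximality bounds the degree from below. *)
move=> x xU; have := hU (U :\ x); rewrite /Phi.
have := edges_in_setD1 se xU; rewrite -(ler_nat R) natrD natrM.
have -> : (#|U :\ x|%:R : R) = #|U|%:R - 1.
  by rewrite [in RHS](cardsD1 x) xU natrD addrC addKr.
set d : R := #|U :&: _|%:R.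
by nra.
Qed.

(** Each chosen vertex costs at most [b] candidates, so at least [c] remain for every choice,
    including the last. The extra [b] on the right stands for [j - 1] in place of [j] without a
    subtraction. *)
Lemma greedy_cliques (e : rel V) (U : {set V}) (b c : R) j (B : {set V}) :
  0 <= c -> (forall x, x \in U -> #|U|%:R - b <= #|U :&: nbhd e x|%:R) ->
  B \subset U -> 0 <= b -> c + j%:R * b <= #|B|%:R + b ->
  c ^+ j <= (num_clique_tuples e j B)%:R.
Proof.
move=> c0 hd; elim: j B => [|j IH] B BU b0 hB.
  rewrite expr0 ler1n /num_clique_tuples card_gt0; apply/set0Pn.
  by exists tt; rewrite inE.
rewrite num_clique_tuplesS natr_sum.
apply: (@le_trans _ _ (\sum_(x in B) c ^+ j)); last first.
  apply: ler_sum => x xB; apply: IH => //; first by rewrite subIset // BU.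
  have := hd x (subsetP BU x xB).
  have h1 : (#|U :&: nbhd e x|%:R : R) <= #|B :&: nbhd e x|%:R + (#|U|%:R - #|B|%:R).
    rewrite addrA lerBrDr -!natrD ler_nat.
    have hs : U :&: nbhd e x \subset (B :&: nbhd e x) :|: (U :\: B).
      by apply/subsetP => y; rewrite !inE => /andP[-> ->]; case: (y \in B).
    have := leq_trans (subset_leq_card hs) (leq_card_setU _ _).
    rewrite cardsD (setIidPr BU) => h; have := subset_leq_card BU; lia.
  move: hB; rewrite -natr1 mulrDl mul1r; lra.
rewrite sumr_const -mulr_natl exprS ler_wpM2r ?exprn_ge0 //.
move: hB; rewrite -natr1 mulrDl mul1r.
have : 0 <= j%:R * b by rewrite mulr_ge0.
lra.
Qed.

(** On a set [U] of minimum degree [(1 - 1/k + eps) * #|U|], [k] greedy choices discard at most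
    [#|U| - k * eps * #|U|] vertices. Each of the [k + 1] choices thus has [eps * #|U|] options, and
    [#|U|] is at least [eps / 2 * #|V|]. *)
Lemma turan_supersaturation (e : rel V) (k : nat) (eps : R) :
  (0 < k)%N -> symmetric e -> 0 < eps -> 2 / eps <= #|V|%:R ->
  (1 - k%:R^-1 + 2 * eps) * #|V|%:R ^+ 2 <= (edges_in e setT)%:R ->
  (eps ^+ 2 / 2 * #|V|%:R) ^+ k.+1 <= (num_clique_tuples e k.+1 setT)%:R.
Proof.
move=> k0 se e0 Vbig hE.
have k0' : (0 : R) < k%:R by rewrite ltr0n.
have kV1 : (k%:R^-1 : R) <= 1 by rewrite invf_le1 ?ler1n.
have V0 : 0 < (#|V|%:R : R) by apply: lt_le_trans Vbig; rewrite divr_gt0.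
have E1 : (edges_in e setT)%:R <= (#|V|%:R ^+ 2 : R).
  rewrite -natrX ler_nat -mulnn -{1}cardsT -sum_nat_const; apply: leq_sum => x _.
  by rewrite max_card.
have e1 : 2 * eps <= k%:R^-1.
  have := le_trans hE E1; rewrite ger_pMl ?exprn_gt0 //; lra.
have ki0 : (0 : R) < k%:R^-1 by rewrite invr_gt0.
have hlam : 0 <= 1 - k%:R^-1 + eps <= 1 by lra.
have heps : 0 < eps <= 1 by lra.
have [|U cU dU] := exists_min_degree se hlam heps Vbig.
  by apply: le_trans hE; rewrite ler_wpM2r ?sqr_ge0 //; lra.
have U0 : (0 : R) <= #|U|%:R by [].
have c0 : 0 <= eps ^+ 2 / 2 * #|V|%:R by rewrite mulr_ge0 ?divr_ge0 ?sqr_ge0.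
have d0 : 0 <= eps * #|U|%:R by rewrite mulr_ge0 // ltW.
apply: (@le_trans _ _ ((eps * #|U|%:R) ^+ k.+1)).
  apply: lerXn2r => //.
  by move: cU; set N := _%:R; nra.
apply: (@le_trans _ _ (num_clique_tuples e k.+1 U)%:R).
  apply: (@greedy_cliques e U ((k%:R^-1 - eps) * #|U|%:R)) => //.
  - by move=> x /dU; nra.
  - by rewrite mulr_ge0 //; lra.
  - rewrite -natr1 mulrDl mul1r.
    have -> : k%:R * ((k%:R^-1 - eps) * #|U|%:R) = #|U|%:R - k%:R * eps * #|U|%:R.
      by field; rewrite lt0r_neq0.
    have : (1 : R) <= k%:R by rewrite ler1n.
    nra.
by rewrite ler_nat; apply: num_clique_tuples_subset; apply: subsetT.
Qed.
End CliqueTuples.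

Lemma sum_setX (R : nmodType) (V : finType) (F : V * V -> R) (X Y : {set V}) :
  \sum_(z in setX X Y) F z = \sum_(x in X) \sum_(y in Y) F (x, y).
Proof.
by rewrite pair_big_dep; apply: eq_big => [[x y]|[x y]]; rewrite ?inE.
Qed.

(** * Many cliques from global density and an upper bound on local density *)

Section DenseCliques.
Variables (R : archiRealFieldType).

Lemma edges_inE (V : finType) (e : rel V) :
  (edges_in e setT)%:R = \sum_z (e z.1 z.2)%:R :> R.
Proof.
rewrite natr_sum -(pair_big predT predT (fun x y => (e x y)%:R)) /=.
apply: eq_big => [x|x _]; first by rewrite inE.
rewrite -sum1_card natr_sum big_mkcond; apply: eq_bigr => y _.
by rewrite !inE; case: (e x y).
Qed.

Definition sig_cell (V : finType) (L : {set {set V}}) x : {set V} :=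
  [set y | signature L y == signature L x].

(** There are at most [2 ^ #|L|] atoms, and each one that counts has fewer than [d] vertices. *)
Lemma card_small_cells (V : finType) (L : {set {set V}}) (d : R) : 0 <= d ->
  \sum_(x | #|sig_cell L x|%:R < d) 1 <= 2 ^+ #|L| * d.
Proof.
move=> d0; rewrite (partition_big (signature L) (mem (powerset L))) /=; last first.
  by move=> x _; rewrite inE; apply/subsetP => X; rewrite inE => /andP[].
have -> : 2 ^+ #|L| * d = \sum_(i in powerset L) d.
  by rewrite sumr_const card_powerset -[RHS]mulr_natl natrX.
apply: ler_sum => i _.
have [x /andP[sx /eqP ix]|none] := pickP [pred x | (#|sig_cell L x|%:R < d) && (signature L x == i)].
  apply: le_trans (ltW sx); rewrite -sum1_card natr_sum big_mkcond [leRHS]big_mkcond.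
  apply: ler_sum => y _; rewrite inE ix.
  by case: (_ == i); rewrite ?andbF //; case: ifP.
by rewrite big_pred0.
Qed.

(** The cell of [z] is a product of two atoms with at least [del * #|V|] vertices each, so the error
    term is at most an [eps] fraction of its size. *)
Lemma cell_avg_signature_le (V : finType) (L : {set {set V}}) (A : V * V -> R)
    (beta eps del : R) z :
  0 <= eps -> 0 <= del ->
  (forall X Y : {set V}, \sum_(z in setX X Y) A z <=
     beta * (#|X|%:R * #|Y|%:R) + del ^+ 2 * eps * #|V|%:R ^+ 2) ->
  del * #|V|%:R <= #|sig_cell L z.1|%:R -> del * #|V|%:R <= #|sig_cell L z.2|%:R ->
  cell_avg (signature2 L) A z <= beta + eps.
Proof.
move=> e0 d0 hA h1 h2; apply: cell_avg_le.
have E y : (signature2 L y == signature2 L z) = (y \in setX (sig_cell L z.1) (sig_cell L z.2)).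
  by case: y => a b; rewrite /signature2 xpair_eqE !inE.
rewrite !(eq_bigl _ _ E); apply: le_trans (hA _ _) _.
have -> : \sum_(z0 in setX (sig_cell L z.1) (sig_cell L z.2)) 1
    = #|sig_cell L z.1|%:R * #|sig_cell L z.2|%:R :> R.
  by rewrite sumr_const cardsX -natrM.
rewrite mulrDl lerD2l.
have -> : del ^+ 2 * eps * #|V|%:R ^+ 2 = eps * ((del * #|V|%:R) * (del * #|V|%:R)) by ring.
by rewrite ler_wpM2l // ler_pM // mulr_ge0.
Qed.

Lemma cell_avg_sym (V : finType) (L : {set {set V}}) (A : V * V -> R) x y :
  (forall x y, A (x, y) = A (y, x)) ->
  cell_avg (signature2 L) A (x, y) = cell_avg (signature2 L) A (y, x).
Proof.
move=> sA; pose sw (z : V * V) := (z.2, z.1).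
have swK : involutive sw by case.
rewrite /cell_avg; congr (_ / _); rewrite (reindex_inj (inv_inj swK)) /=;
  by apply: eq_big => [[a b]|[a b] _] //; rewrite /signature2 !xpair_eqE andbC.
Qed.

(** A pair lies in a small atom on one side, or has average below [eps / 4], or has average at most
    [beta + eps / 4]. The first two kinds contribute at most [eps / 2 * #|V| ^+ 2] together, so the
    support must carry the rest. *)
Lemma dense_support (V : finType) (L : {set {set V}}) (A : V * V -> R)
    (beta eps del theta : R) :
  0 < beta <= 1 -> 0 < eps -> 0 <= del -> del * 2 ^+ #|L| <= eps / 8 ->
  (forall z, 0 <= A z <= 1) ->
  (forall X Y : {set V}, \sum_(z in setX X Y) A z <=
     beta * (#|X|%:R * #|Y|%:R) + del ^+ 2 * (eps / 4) * #|V|%:R ^+ 2) ->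
  (beta * theta + eps) * #|V|%:R ^+ 2 <= \sum_z A z ->
  (theta + eps / 4) * #|V|%:R ^+ 2 <=
    \sum_z (eps / 4 <= cell_avg (signature2 L) A z)%R%:R.
Proof.
move=> /andP[b0 b1] e0 d0 hdel A01 hA hsum.
set g := cell_avg _ _; set N : R := #|V|%:R.
set S := \sum_z _%:R.
have N0 : 0 <= N by [].
have g1 z : g z <= 1 by apply: cell_avg_le1 => y; case/andP: (A01 y).
pose small x := #|sig_cell L x|%:R < del * N.
have gsum : \sum_z g z = \sum_z A z.
  have := sum_cell_avg (signature2 L) A (fun=> 1 : R).
  by under eq_bigr => z _ do rewrite mulr1; under [X in _ = X]eq_bigr => z _ do rewrite mulr1.
have gcell z : del * N <= #|sig_cell L z.1|%:R -> del * N <= #|sig_cell L z.2|%:R ->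
    g z <= beta + eps / 4.
  by apply: cell_avg_signature_le => //; rewrite divr_ge0 // ltW.
clearbody g.
have gle z : g z <= eps / 4 + (beta + eps / 4) * (eps / 4 <= g z)%R%:R +
      (small z.1)%:R + (small z.2)%:R.
  have hS0 : 0 <= (beta + eps / 4) * (eps / 4 <= g z)%R%:R.
    by rewrite mulr_ge0 // addr_ge0 ?divr_ge0 // ltW.
  have e40 : 0 <= eps / 4 by rewrite divr_ge0 // ltW.
  have [s1|] := boolP (small z.1).
    apply: (le_trans (g1 z)); apply: ler_wpDr => //.
    by rewrite ler_wpDl // addr_ge0.
  rewrite {1}/small -leNgt => l1.
  have [s2|] := boolP (small z.2).
    apply: (le_trans (g1 z)); rewrite addr0; apply: ler_wpDl => //; exact: addr_ge0.
  rewrite {1}/small -leNgt => l2; rewrite !addr0.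
  case: (lerP (eps / 4) (g z)) => h /=; last by rewrite mulr0 addr0 ltW.
  by rewrite mulr1 ler_wpDl // gcell.
have hsm : \sum_x (small x)%:R <= eps / 8 * N.
  have -> : \sum_x (small x)%:R = \sum_(x | small x) (1 : R).
    by rewrite [RHS]big_mkcond; apply: eq_bigr => x _; case: (small x).
  apply: le_trans (card_small_cells L _) _; first by rewrite mulr_ge0.
  by rewrite mulrA ler_wpM2r // mulrC.
have sN : \sum_(z : V * V) 1 = N ^+ 2 by rewrite sumr_const card_prod natrM expr2.
have h1 : \sum_(z : V * V) (small z.1)%:R <= eps / 8 * N ^+ 2.
  rewrite -(pair_bigA _ (fun x (y : V) => (small x)%:R)) /=.
  have cE x : \sum_(y : V) (small x)%:R = (small x)%:R * N :> R.
    by rewrite sumr_const mulr_natr.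
  by rewrite (eq_bigr _ (fun x _ => cE x)) -mulr_suml expr2 mulrA ler_wpM2r.
have h2 : \sum_(z : V * V) (small z.2)%:R <= eps / 8 * N ^+ 2.
  rewrite -(pair_bigA _ (fun (x : V) y => (small y)%:R)) /=.
  by rewrite sumr_const -[_ *+ #|_|]mulr_natr expr2 mulrA ler_wpM2r.
have tot : \sum_z g z <= eps / 4 * N ^+ 2 + (beta + eps / 4) * S +
    eps / 8 * N ^+ 2 + eps / 8 * N ^+ 2.
  apply: (le_trans (ler_sum _ (fun z _ => gle z))).
  rewrite !big_split /= sumr_const -[_ *+ #|_|]mulr_natr card_prod natrM.
  apply: lerD h2; apply: lerD h1.
  by rewrite /S [in leRHS]mulr_sumr lerD2r -/N -expr2.
have SN : S <= N ^+ 2.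
  by rewrite -sN; apply: ler_sum => z _; case: (eps / 4 <= g z).
clearbody S.
have N20 : 0 <= N ^+ 2 by rewrite sqr_ge0.
move: hsum; rewrite -gsum -/N => hsum.
have eSN : eps / 4 * S <= eps / 4 * N ^+ 2 by rewrite ler_wpM2l // divr_ge0 // ltW.
have eN : eps / 4 * (beta * N ^+ 2) <= eps / 4 * N ^+ 2.
  by rewrite ler_wpM2l ?divr_ge0 ?(ltW e0) // ler_piMl.
have {hsum tot} := le_trans hsum tot; move: eSN eN; clear -b0; move: (N ^+ 2) => n2.
move=> eSN eN hsum; rewrite -(ler_pM2l b0); lra.
Qed.

Lemma hom_density_sum_ge (V : finType) q (g : V * V -> R) (eta : R) :
  0 <= eta -> (forall z, 0 <= g z) ->
  eta ^+ #|@edge_pair q| * hom_density_sum q (fun z => (eta <= g z)%R%:R)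
    <= hom_density_sum q g.
Proof.
move=> eta0 g0; rewrite /hom_density_sum mulr_sumr; apply: ler_sum => f _.
rewrite -prodr_const -big_split /=; apply: ler_prod => ij _.
rewrite mulr_ge0 //=; case: (lerP eta (g _)) => h; first by rewrite mulr1.
by rewrite mulr0.
Qed.

Lemma dense_clique_tuples (beta eps : R) (k : nat) :
  (0 < k)%N -> 0 < beta <= 1 -> 0 < eps ->
  exists kap c N0 : R, [/\ 0 < kap, 0 < c &
    forall (V : finType) (e : rel V), symmetric e -> N0 <= #|V|%:R ->
    (forall X Y : {set V}, \sum_(z in setX X Y) (e z.1 z.2)%:R <=
       beta * (#|X|%:R * #|Y|%:R) + kap * #|V|%:R ^+ 2) ->
    (beta * (1 - k%:R^-1) + eps) * #|V|%:R ^+ 2 <= (edges_in e setT)%:R ->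
    c * #|V|%:R ^+ k.+1 <= (num_clique_tuples e k.+1 setT)%:R].
Proof.
move=> k0 b01 e0; set q := k.+1.
(* Clique density of the step function: [eps / 4] for each edge, times the supersaturation count
   with parameter [eps / 8]. *)
pose c2 : R := (eps / 4) ^+ #|@edge_pair q| * ((eps / 8) ^+ 2 / 2) ^+ q.
have c20 : 0 < c2 by rewrite mulr_gt0 // exprn_gt0 // divr_gt0 // exprn_gt0 // divr_gt0.
(* Chosen so that the counting error, [q ^ 2 * gam] after normalization, is half of [c2]. *)
pose gam := c2 / (2 * (q ^ 2)%:R).
have q20 : (0 : R) < (q ^ 2)%:R by rewrite ltr0n.
have gam0 : 0 < gam by rewrite divr_gt0 // mulr_gt0.
pose j := (Num.truncn (gam ^- 2)).+1.
have gj : 1 < gam ^+ 2 * j%:R.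
  rewrite mulrC -ltr_pdivrMr ?exprn_gt0 // mul1r /j.
  exact: truncnS_gt.
(* With at most [2 ^ (2 * j)] atoms, those smaller than [del * #|V|] cover at most an [eps / 8]
   fraction of the vertices. *)
pose del : R := eps / 8 / 2 ^+ (2 * j).
have del0 : 0 < del by rewrite divr_gt0 ?exprn_gt0 // divr_gt0.
exists (del ^+ 2 * (eps / 4)), (c2 / 2), (2 / (eps / 8) + 1); split.
- by rewrite mulr_gt0 ?exprn_gt0 // divr_gt0.
- by rewrite divr_gt0.
move=> V e se VN hXY hE; set N : R := #|V|%:R in VN hXY hE *.
have N0 : 0 < N.
  by apply: lt_le_trans VN; rewrite ltr_wpDl // ltW // divr_gt0 // divr_gt0.
pose A (z : V * V) : R := (e z.1 z.2)%:R.
have A01 z : 0 <= A z <= 1 by rewrite /A; case: (e _ _); rewrite ?lexx ler01.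
have [L cL hL] := weak_regularity gam0 gj A01.
pose g := cell_avg (signature2 L) A.
have g01 z : 0 <= g z <= 1.
  rewrite cell_avg_ge0 ?cell_avg_le1 // => y; by case/andP: (A01 y).
have hdel : del * 2 ^+ #|L| <= eps / 8.
  rewrite /del -mulrA ger_pMr ?divr_gt0 // mulrC ler_pdivrMr ?exprn_gt0 // mul1r.
  by rewrite ler_weXn2l // ler1n.
have hS := @dense_support V L A beta eps del (1 - k%:R^-1) b01 e0 (ltW del0) hdel A01 hXY.
rewrite -/N -edges_inE in hS; move: (hS hE) => {}hS.
pose s := [rel x y | eps / 4 <= g (x, y)].
have ss : symmetric s.
  by move=> x y /=; rewrite /g cell_avg_sym // => a b; rewrite /A /= se.
have e80 : 0 < eps / 8 by rewrite divr_gt0.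
have VN' : 2 / (eps / 8) <= N by apply: le_trans VN; rewrite lerDl.
have hT : (((eps / 8) ^+ 2 / 2) * N) ^+ q <= (num_clique_tuples s q setT)%:R.
  apply: turan_supersaturation => //.
  rewrite edges_inE -/N.
  have -> : 2 * (eps / 8) = eps / 4 by field.
  apply: (le_trans hS); rewrite le_eqVlt; apply/orP; left; apply/eqP.
  by apply: eq_bigr => -[x y].
have eta0 : 0 <= eps / 4 by rewrite divr_ge0 // ltW.
have hg : c2 * N ^+ q <= hom_density_sum q g.
  apply: le_trans (hom_density_sum_ge q eta0 (fun z => proj1 (andP (g01 z)))).
  rewrite /c2 -mulrA -exprMn ler_wpM2l ?exprn_ge0 //.
  apply: (le_trans hT).
  rewrite -hom_density_sum_indicator le_eqVlt; apply/orP; left; apply/eqP.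
  by apply: eq_bigr => f _; apply: eq_bigr => ij _.
have := @counting_lemma R V q A g _ A01 g01 hL.
rewrite card_prod natrM -/N /A hom_density_sum_indicator.
set T : R := (num_clique_tuples _ _ _)%:R; set G := hom_density_sum _ _.
have -> : (q ^ 2)%:R * (gam * (N * N) * N ^+ q) = N ^+ 2 * (c2 / 2 * N ^+ q).
  by rewrite /gam; field; rewrite lt0r_neq0.
rewrite ler_pM2l ?exprn_gt0 // => h.
rewrite distrC in h; have := le_trans (ler_norm (G - T)) h.
by move: hg; rewrite -/G; clear; lra.
Qed.
End DenseCliques.

(** * Dependent random choice *)

Section DependentRandomChoice.
Variables (R : realFieldType).

(** Convexity of the power function: it lies above its tangent at [a]. Summing over [I] yields
    Jensen's inequality in [sum_expr_ge]. *)
Lemma expr_tangent_le (x a : R) s : 0 <= x -> 0 <= a ->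
  a ^+ s + s%:R * a ^+ s.-1 * (x - a) <= x ^+ s.
Proof.
move=> x0 a0; elim: s => [|[|s] IH]; first by rewrite !expr0 mul0r mul0r addr0.
  by rewrite !expr1 expr0 !mul1r addrC subrK.
move: IH; rewrite /= ![_ ^+ s.+2]exprS => IH.
apply: le_trans (ler_wpM2l x0 IH); rewrite -subr_ge0.
have -> : x * (a ^+ s.+1 + s.+1%:R * a ^+ s * (x - a)) -
    (a * a ^+ s.+1 + s.+2%:R * a ^+ s.+1 * (x - a)) =
    s.+1%:R * a ^+ s * (x - a) ^+ 2.
  by rewrite -[s.+2%:R]natr1 !exprS; ring.
by rewrite mulr_ge0 ?sqr_ge0 // mulr_ge0 // exprn_ge0.
Qed.

Lemma sum_expr_ge (I : finType) (d : I -> R) (a : R) s :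
  0 <= a -> (forall i, 0 <= d i) -> #|I|%:R * a <= \sum_i d i ->
  #|I|%:R * a ^+ s <= \sum_i d i ^+ s.
Proof.
move=> a0 d0 hd.
apply: le_trans (ler_sum _ (fun i _ => expr_tangent_le s (d0 i) a0)).
rewrite big_split /= -mulr_sumr sumrB !sumr_const -[a ^+ s *+ _]mulr_natl.
rewrite -[a *+ _]mulr_natl lerDl mulr_ge0 ?subr_ge0 // mulr_ge0 // exprn_ge0 //.
Qed.

Lemma bin_le_expn n p : ('C(n, p) <= n ^ p)%N.
Proof.
apply: (@leq_trans (n ^_ p)); first by rewrite -bin_ffact leq_pmulr // fact_gt0.
elim: p n => [|p IH] n; first by [].
rewrite ffactnS expnS leq_mul2l; apply/orP; right.
by apply: leq_trans (IH _) _; rewrite ?leq_pred //; case: (p) => // p'; rewrite leq_exp2r ?leq_pred.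
Qed.

Definition common_link (V W : finType) (E : V -> W -> bool) (A : {set V}) : {set W} :=
  [set w | [forall x in A, E x w]].

(* The common neighbourhood U w of a random s-tuple w of elements of W is large
   on average, and typically contains no p-set with a small common link. *)
Lemma dependent_random_choice (V W : finType) (E : V -> W -> bool)
    (p s m : nat) (Q : pred {set V}) (eps del : R) :
  (0 < #|W|)%N -> (0 < m)%N -> 0 <= eps -> 0 <= del ->
  (forall U : {set V}, (m <= #|U|)%N -> exists A : {set V}, [/\ A \subset U, #|A| = p & Q A]) ->
  eps * (#|V|%:R * #|W|%:R) <= (\sum_x #|[set w | E x w]|)%N%:R ->
  m%:R <= #|V|%:R * eps ^+ s - #|V|%:R ^+ p.+1 * del ^+ s ->
  exists A : {set V}, [/\ #|A| = p, Q A & del * #|W|%:R <= #|common_link E A|%:R].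
Proof.
move=> W0 m0 e0 d0 hQ hE hm.
set N : R := #|V|%:R in hE hm *; set M : R := #|W|%:R in hE *.
have M0 : 0 < M by rewrite ltr0n.
have N0 : 0 <= N by [].
pose bad (A : {set V}) := (#|A| == p) && (#|common_link E A|%:R < del * M).
have [/existsP[A /and3P[/eqP cA QA lA]]|/existsPn none] := boolP [exists A : {set V},
  [&& #|A| == p, Q A & del * M <= #|common_link E A|%:R]].
  by exists A.
exfalso.
pose U (w : {ffun 'I_s -> W}) : {set V} := [set x | [forall i, E x (w i)]].
pose nb (w : {ffun 'I_s -> W}) : nat := #|[set A | bad A & A \subset U w]|.
(* If no set is good, every sample with [#|U w| >= m] contains a bad set, and the term [N * nb w]
   pays for all of [U w]. The [+ 1] makes the final comparison strict. *)
have hU w : (#|U w|%:R : R) + 1 <= m%:R + N * (nb w)%:R.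
  have [mU|Um] := leqP m #|U w|; last first.
    rewrite natr1; apply: (@le_trans _ _ m%:R); first by rewrite ler_nat.
    by rewrite lerDl mulr_ge0.
  have nb1 : (0 < nb w)%N.
    have [A [AU cA QA]] := hQ _ mU; rewrite card_gt0; apply/set0Pn; exists A.
    rewrite inE AU andbT /bad cA eqxx /= ltNge; apply: contraT; rewrite negbK => lA.
    by have := none A; rewrite cA eqxx QA lA.
  rewrite addrC lerD ?ler1n //.
  apply: (@le_trans _ _ (N * 1)); first by rewrite mulr1 ler_nat max_card.
  by rewrite ler_wpM2l // ler1n.
have cFS (D : {set W}) : #|[set w : {ffun 'I_s -> W} | [forall i, w i \in D]]| = (#|D| ^ s)%N.
  rewrite -[in RHS](card_ord s) -card_ffun_on; apply: eq_card => w; rewrite inE.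
  by apply/forallP/ffun_onP.
have sumM : \sum_(w : {ffun 'I_s -> W}) (1 : R) = M ^+ s.
  by rewrite sumr_const card_ffun card_ord natrX.
have SU : N * eps ^+ s * M ^+ s <= \sum_w #|U w|%:R.
  have -> : \sum_w (#|U w|%:R : R) = \sum_x (#|[set w | E x w]|%:R : R) ^+ s.
    under eq_bigr => w _ do rewrite -sum1_card natr_sum big_mkcond.
    rewrite exchange_big; apply: eq_bigr => x _.
    rewrite -natrX -cFS -sum1_card natr_sum [RHS]big_mkcond.
    apply: eq_bigr => w _; rewrite !inE; congr (if _ then _ else _).
    by apply: eq_forallb => i; rewrite inE.
  rewrite -mulrA -exprMn; apply: sum_expr_ge => //; first by rewrite mulr_ge0 // ltW.
  by move: hE; rewrite natr_sum; apply: le_trans; rewrite -/N; nra.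
(* [A] lies in [U w] exactly when all coordinates of [w] lie in the common link of [A], which for a
   bad [A] has fewer than [del * M] elements. *)
have SB : \sum_w (nb w)%:R <= N ^+ p * del ^+ s * M ^+ s :> R.
  have -> : \sum_w ((nb w)%:R : R) = \sum_(A | bad A) (#|common_link E A|%:R : R) ^+ s.
    under eq_bigr => w _ do rewrite /nb -sum1_card natr_sum big_mkcond.
    rewrite exchange_big [RHS]big_mkcond; apply: eq_bigr => A _.
    case: ifP => bA; last by rewrite big1 // => w _; rewrite inE bA.
    rewrite -natrX -cFS -sum1_card natr_sum [RHS]big_mkcond.
    apply: eq_bigr => w _; rewrite !inE bA /=; congr (if _ then _ else _).
    apply/subsetP/forallP => h.
      move=> i; rewrite inE; apply/forall_inP => x xA.
      by have := h x xA; rewrite inE => /forallP.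
    move=> x xA; rewrite inE; apply/forallP => i.
    by have := h i; rewrite inE => /forall_inP; apply.
  apply: (@le_trans _ _ (\sum_(A : {set V} | #|A| == p) (del * M) ^+ s)).
    rewrite [leLHS]big_mkcond [leRHS]big_mkcond; apply: ler_sum => A _.
    rewrite /bad; case: (#|A| == p) => //=; case: ifP => [lA|_].
      by apply: lerXn2r; rewrite ?nnegrE ?mulr_ge0 // ltW.
    by rewrite exprn_ge0 // mulr_ge0 // ltW.
  rewrite sumr_const exprMn -mulr_natl -mulrA ler_wpM2r //.
    by rewrite mulr_ge0 // exprn_ge0 // ltW.
  rewrite -natrX ler_nat -[X in (X <= _)%N]cardsE card_draws.
  exact: bin_le_expn.
have tot : \sum_w (#|U w|%:R + 1 : R) <= \sum_w (m%:R + N * (nb w)%:R).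
  by apply: ler_sum => w _; apply: hU.
move: tot; rewrite !big_split /= -mulr_sumr sumM.
have -> : \sum_(w : {ffun 'I_s -> W}) (m%:R : R) = m%:R * M ^+ s.
  by rewrite -sumM mulr_sumr; apply: eq_bigr => w _; rewrite mulr1.
have M_s : 0 < M ^+ s by rewrite exprn_gt0.
have := ler_wpM2l N0 SB; have := ler_wpM2r (ltW M_s) hm.
have -> : (N * eps ^+ s - N ^+ p.+1 * del ^+ s) * M ^+ s =
  N * eps ^+ s * M ^+ s - N * (N ^+ p * del ^+ s * M ^+ s) by rewrite exprS; ring.
lra.
Qed.
End DependentRandomChoice.

(** * Cliques and the iteration of dependent random choice *)

Definition clique (V : finType) (e : rel V) (A : {set V}) :=
  [forall x in A, forall y in A, (x != y) ==> e x y].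

Lemma cliqueP (V : finType) (e : rel V) (A : {set V}) :
  reflect {in A &, forall x y, x != y -> e x y} (clique e A).
Proof.
apply: (iffP forall_inP) => h x.
  by move=> y xA yA; move/forall_inP: (h x xA) => /(_ y yA) /implyP.
by move=> xA; apply/forall_inP => y yA; apply/implyP => /(h x y xA yA).
Qed.

Lemma clique_join (V : finType) (e : rel V) (A C : {set V}) :
  symmetric e -> irreflexive e -> clique e A -> clique e C ->
  {in A & C, forall x y, e x y} ->
  #|A :|: C| = (#|A| + #|C|)%N /\ clique e (A :|: C).
Proof.
move=> se irr QA QC AC; split.
  suff AC0 : A :&: C = set0 by rewrite cardsU AC0 cards0 subn0.
  apply/setP => z; rewrite !inE; apply/negP => /andP[zA zC].
  by have := AC z z zA zC; rewrite irr.
apply/cliqueP => x y; rewrite !inE => /orP[xA|xC] /orP[yA|yC] xy.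
- exact: (cliqueP _ _ QA).
- exact: AC.
- by rewrite se; exact: AC.
- exact: (cliqueP _ _ QC).
Qed.

(** Membership passes to the intersection of the sets [C x], while the adjacencies within the tuple
    are inherited from the single member [x0]. *)
Lemma clique_tuple_bigcap (V : finType) (e : rel V) k (A : {set V}) (C : V -> {set V})
    (x0 : V) (w : tup V k) :
  x0 \in A -> (forall x, x \in A -> clique_tuple e (C x) w) ->
  clique_tuple e [set y | [forall x in A, y \in C x]] w.
Proof.
move=> x0A; elim: k C w => //= k IH C [y w] /= h.
rewrite inE; apply/andP; split.
  by apply/forall_inP => x /h /andP[].
apply: clique_tuple_subset (IH (fun x => C x :&: nbhd e y) w _); last first.
  by move=> x /h /andP[].
apply/subsetP => z; rewrite !inE => /forall_inP hz; apply/andP; split.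
  by apply/forall_inP => x /hz; rewrite inE => /andP[].
by have := hz x0 x0A; rewrite !inE => /andP[].
Qed.

(** Induction on [k]: random choice in the bipartite graph between vertices and shorter tuples given
    by [F] yields a clique [A] of size [p] with dense common link [G]. All tuples of [G] lie in the
    common neighbourhood of [A], where the induction hypothesis, with [eps] and [s] shifted, finds
    the rest. *)
Lemma iterated_random_choice (R : realFieldType) (V : finType) (e : rel V) (p m k : nat)
    (eps : nat -> R) (s : nat -> nat) (B : {set V}) (F : {set tup V k}) :
  symmetric e -> irreflexive e -> (0 < p)%N -> (0 < m)%N -> (forall i, 0 < eps i) ->
  (forall U : {set V}, (m <= #|U|)%N ->
     exists A : {set V}, [/\ A \subset U, #|A| = p & clique e A]) ->
  (forall i, (i < k)%N -> m%:R <= #|V|%:R * eps i ^+ s i -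
      #|V|%:R ^+ p.+1 * eps i.+1 ^+ s i) ->
  (forall w, w \in F -> clique_tuple e B w) ->
  eps 0 * #|V|%:R ^+ k <= #|F|%:R ->
  exists A : {set V}, [/\ A \subset B, #|A| = (k * p)%N & clique e A].
Proof.
move=> se irr p0 m0 + hm; elim: k eps s B F => [|k IH] eps s B F eps0 hs hF cF.
  exists set0; rewrite sub0set cards0 mul0n; split=> //.
  by apply/cliqueP => x y; rewrite inE.
have V0 : (0 < #|V|)%N.
  rewrite lt0n; apply/eqP => v0; have := hs 0 isT; rewrite v0 mul0r expr0n mul0r subr0.
  by rewrite lern0; case: (m) m0.
have V0' : (0 : R) < #|V|%:R by rewrite ltr0n.
have W0 : (0 < #|{: tup V k}|)%N by rewrite card_tup expn_gt0 V0.
have hE : eps 0 * (#|V|%:R * #|{: tup V k}|%:R) <=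
   (\sum_x #|[set w : tup V k | (x, w) \in F]|)%N%:R.
  rewrite card_tup natrX -exprS; apply: (le_trans cF); rewrite ler_nat.
  rewrite -[#|F|]sum1_card.
  under [X in (_ <= X)%N]eq_bigr => x _ do rewrite -sum1_card.
  rewrite pair_big_dep /=; apply/eq_leq/eq_bigl => -[x w].
  by rewrite inE.
have [A [cA QA lA]] := dependent_random_choice W0 m0 (ltW (eps0 0)) (ltW (eps0 1))
  hm hE (hs 0 isT).
have [x0 x0A] : exists x0, x0 \in A by apply/set0Pn; rewrite -card_gt0 cA.
set G := common_link _ A in lA.
have GF w x : w \in G -> x \in A -> (x \in B) && clique_tuple e (B :&: nbhd e x) w.
  by rewrite inE => /forall_inP h /h /hF.
have [C [CB cC QC]] : exists C : {set V},
  [/\ C \subset [set y | [forall x in A, y \in B :&: nbhd e x]], #|C| = (k * p)%N & clique e C].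
  apply: (IH (fun i => eps i.+1) (fun i => s i.+1) _ G) => //.
  - by move=> i ik; apply: hs.
  - by move=> w wG; apply: clique_tuple_bigcap x0A _ => x xA; case/andP: (GF w x wG xA).
  - by move: lA; rewrite card_tup natrX.
(* [C] is empty when [k = 0], so [A \subset B] is read off from an element of [G]. *)
have [w wG] : exists w, w \in G.
  apply/set0Pn; rewrite -card_gt0 -(ltr0n R); apply: lt_le_trans lA.
  by rewrite mulr_gt0 // ltr0n.
have CE y x : y \in C -> x \in A -> (y \in B) && e x y.
  by move=> /(subsetP CB); rewrite inE => /forall_inP h /h; rewrite !inE.
have [cAC QAC] : #|A :|: C| = (#|A| + #|C|)%N /\ clique e (A :|: C).
  by apply: clique_join => // x y xA yC; case/andP: (CE y x yC xA).
exists (A :|: C); rewrite cAC cA cC mulSn; split=> //.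
rewrite subUset; apply/andP; split; apply/subsetP => x xA.
  by case/andP: (GF w x wG xA).
by case/andP: (CE x x0 xA x0A).
Qed.

(** * Graphs of small independence number *)

Section LocalDensity.
Variables (R : realFieldType) (V : finType) (e : rel V).

Lemma card_common_nbhd (A Y : {set V}) :
  (#|Y| <= #|[set y in Y | [forall x in A, e x y]]| + \sum_(x in A) #|Y :\: nbhd e x|)%N.
Proof.
rewrite -[X in (X <= _)%N](cardsID [set y | [forall x in A, e x y]]).
rewrite setIdE leq_add2l.
have -> : Y :\: [set y | [forall x in A, e x y]] = \bigcup_(x in A) (Y :\: nbhd e x).
  apply/setP => y; rewrite !inE; apply/andP/bigcupP => [[/forall_inPn[x xA nxy] yY]|[x xA]].
    by exists x; rewrite ?inE ?nxy.
  rewrite !inE => /andP[nxy yY]; split=> //.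
  by apply/forall_inPn; exists x.
rewrite [\sum_(x in A) _]big_mkcond [\bigcup_(x in A) _]big_mkcond /=.
elim/big_rec2: _ => [|x n U _ le]; first by rewrite cards0.
apply: leq_trans (leq_card_setU _ _) _; rewrite leq_add //.
by case: ifP; rewrite ?cards0.
Qed.

(** Each vertex of a [t]-clique [A] of high-degree vertices misses at most [(1/t - eps) * #|Y|] of
    [Y], so [A] has at least [m] common neighbours in [Y]. These contain a second [t]-clique, and
    the two form a forbidden [2 * t]-clique. *)
Lemma few_high_degree (t m : nat) (eps : R) (Y : {set V}) :
  (0 < t)%N -> symmetric e -> irreflexive e ->
  (forall A : {set V}, clique e A -> #|A| != (2 * t)%N) ->
  (forall U : {set V}, (m <= #|U|)%N ->
     exists A : {set V}, [/\ A \subset U, #|A| = t & clique e A]) ->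
  m%:R <= t%:R * eps * #|Y|%:R ->
  (#|[set x | ((1 - t%:R^-1 + eps) * #|Y|%:R <= #|Y :&: nbhd e x|%:R)%R]| < m)%N.
Proof.
move=> t0 se irr free hm mY; rewrite ltnNge; apply/negP => /hm [A [AX cA QA]].
pose C := [set y in Y | [forall x in A, e x y]].
have t0' : (0 : R) < t%:R by rewrite ltr0n.
have mC : (m <= #|C|)%N.
  rewrite -(ler_nat R); apply: (le_trans mY).
  have := card_common_nbhd A Y; rewrite -/C -(ler_nat R) natrD natr_sum => h.
  have : \sum_(x in A) (#|Y :\: nbhd e x|%:R : R) <= \sum_(x in A) (t%:R^-1 - eps) * #|Y|%:R.
    apply: ler_sum => x /(subsetP AX); rewrite inE => hx.
    have : (#|Y|%:R : R) = #|Y :&: nbhd e x|%:R + #|Y :\: nbhd e x|%:R.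
      by rewrite -natrD cardsID.
    lra.
  have -> : \sum_(x in A) (t%:R^-1 - eps) * #|Y|%:R = #|Y|%:R - t%:R * eps * #|Y|%:R.
    by rewrite sumr_const cA -[LHS]mulr_natr; field; rewrite lt0r_neq0.
  lra.
have [D [DC cD QD]] := hm _ mC.
have [|cAD QAD] := clique_join se irr QA QD.
  by move=> x y xA /(subsetP DC); rewrite inE => /andP[_ /forall_inP]; apply.
by have := free _ QAD; rewrite cAD cA cD addnn mul2n eqxx.
Qed.

Lemma local_density (t m : nat) (kap : R) (X Y : {set V}) :
  (0 < t)%N -> symmetric e -> irreflexive e -> 0 < kap <= 1 ->
  (forall A : {set V}, clique e A -> #|A| != (2 * t)%N) ->
  (forall U : {set V}, (m <= #|U|)%N ->
     exists A : {set V}, [/\ A \subset U, #|A| = t & clique e A]) ->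
  m%:R <= kap ^+ 2 / 2 * #|V|%:R ->
  \sum_(z in setX X Y) (e z.1 z.2)%:R <=
     (1 - t%:R^-1) * (#|X|%:R * #|Y|%:R) + kap * #|V|%:R ^+ 2.
Proof.
move=> t0 se irr /andP[k0 k1] free hm mV.
have t0' : (1 : R) <= t%:R by rewrite ler1n.
have ti0 : (0 : R) <= 1 - t%:R^-1 by rewrite subr_ge0 invf_le1 // ltr0n.
set N : R := #|V|%:R in mV *.
have XN : (#|X|%:R : R) <= N by rewrite ler_nat max_card.
have YN : (#|Y|%:R : R) <= N by rewrite ler_nat max_card.
have X0 : (0 : R) <= #|X|%:R by [].
have Y0 : (0 : R) <= #|Y|%:R by [].
have XY0 : (0 : R) <= #|X|%:R * #|Y|%:R by rewrite mulr_ge0.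
have m0 : (0 : R) <= m%:R by [].
(* If [Y] is large, the fewer than [m] exceptional vertices cost at most [m * N]; otherwise
   [#|Y| <= kap * N] and the trivial bound suffices. *)
have [mY|Ym] := lerP m%:R (t%:R * (kap / 2) * #|Y|%:R).
  have hX := few_high_degree t0 se irr free hm mY.
  set X' := [set x | _] in hX.
  have -> : \sum_(z in setX X Y) (e z.1 z.2)%:R = \sum_(x in X) (#|Y :&: nbhd e x|%:R : R).
    rewrite sum_setX; apply: eq_bigr => x _.
    rewrite -sum1_card natr_sum big_mkcond [RHS]big_mkcond; apply: eq_bigr => y _.
    by rewrite !inE; case: (y \in Y); case: (e x y).
  apply: (@le_trans _ _ (\sum_(x in X) ((1 - t%:R^-1 + kap / 2) * #|Y|%:R) +
     \sum_(x in X') N)).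
    rewrite [\sum_(x in X') N]big_mkcond [X in _ <= X + _]big_mkcond [leLHS]big_mkcond.
    rewrite -big_split /=.
    apply: ler_sum => x _ /=; rewrite inE.
    have dN : (#|Y :&: nbhd e x|%:R : R) <= N by rewrite ler_nat max_card.
    have N0 : 0 <= N by [].
    have [h|h] := lerP (_ * #|Y|%:R) #|Y :&: nbhd e x|%:R.
      case: (x \in X); last by rewrite add0r.
      by rewrite ler_wpDl // mulr_ge0 //; lra.
    by rewrite addr0; case: (x \in X) => //; apply: ltW.
  rewrite !sumr_const -[_ *+ #|X|]mulr_natl -[N *+ _]mulr_natl.
  have h1 : kap / 2 * (#|X|%:R * #|Y|%:R) <= kap / 2 * N ^+ 2.
    by rewrite ler_wpM2l ?divr_ge0 ?(ltW k0) // expr2 ler_pM.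
  have h2 : (#|X'|%:R : R) * N <= m%:R * N by rewrite ler_wpM2r // ler_nat ltnW.
  have h3 : (m%:R : R) * N <= kap / 2 * N ^+ 2.
    rewrite expr2 mulrA ler_wpM2r // (le_trans mV) // ler_wpM2r //.
    by rewrite expr2 -mulrA ler_piMl // divr_ge0 // ltW.
  move: h1 h2 h3; move: (#|X|%:R : R) (#|Y|%:R : R) (#|X'|%:R : R) (m%:R : R) => x y x' mm.
  clear; lra.
apply: (@le_trans _ _ (#|X|%:R * #|Y|%:R)).
  rewrite -natrM -cardsX -sum1_card natr_sum; apply: ler_sum => z _.
  by case: (e _ _).
have Y1 : #|Y|%:R <= kap * N.
  have k20 : 0 < kap / 2 by rewrite divr_gt0.
  rewrite -(ler_pM2l k20) mulrA -[kap / 2 * kap]mulrAC -expr2.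
  apply: le_trans mV; apply: le_trans (ltW Ym).
  by rewrite -mulrA ler_peMl // mulr_ge0 // ltW.
apply: (@le_trans _ _ (kap * N ^+ 2)); last by rewrite lerDr mulr_ge0.
by rewrite expr2 mulrA mulrC ler_pM.
Qed.
End LocalDensity.

(** * Passage to [sgraph], [contains] and [Qmin] *)

Section GraphCliques.
Implicit Types (T : finType).

Lemma adj_sym T (G : sgraph T) : symmetric (adj G).
Proof. by move=> x y; rewrite /adj setUC. Qed.

Lemma edge_card T (G : sgraph T) (e : {set T}) : e \in edges G -> #|e| = 2%N.
Proof. by case: G => E /= /forall_inP h /h /eqP. Qed.

Lemma adj_irrefl T (G : sgraph T) : irreflexive (adj G).
Proof. by move=> x; apply/negP => /edge_card; rewrite setUid cards1. Qed.

Lemma adj_complete t (i j : 'I_t) : adj (complete t) i j = (i != j).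
Proof. by rewrite /adj inE cards2; case: (i == j). Qed.

Lemma contains_completeP T (G : sgraph T) t :
  reflect (exists2 A : {set T}, #|A| = t & clique (adj G) A) (contains (complete t) G).
Proof.
apply: (iffP existsP) => [[f /andP[/injectiveP f_inj /forallP h]]|[A cA /cliqueP QA]].
  exists (f @: setT); first by rewrite card_imset // cardsT card_ord.
  apply/cliqueP => _ _ /imsetP[i _ ->] /imsetP[j _ ->] fij.
  move/forallP: (h i) => /(_ j) /implyP; apply; rewrite adj_complete.
  by apply: contra_neq fij => ->.
exists [ffun i => enum_val (cast_ord (esym cA) i)]; apply/andP; split.
  by apply/injectiveP => i j; rewrite !ffunE => /enum_val_inj /cast_ord_inj.
apply/forallP => i; apply/forallP => j; apply/implyP; rewrite adj_complete !ffunE => ij.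
apply: QA; rewrite ?enum_valP //.
by apply: contra_neq ij => /enum_val_inj /cast_ord_inj.
Qed.

(** Every edge arises from two distinct ordered pairs of its ends. *)
Lemma sum_adj T (G : sgraph T) : (2 * #|edges G| <= edges_in (adj G) setT)%N.
Proof.
have -> : edges_in (adj G) setT = (\sum_(z : T * T | adj G z.1 z.2) 1)%N.
  rewrite -(pair_big_dep predT (fun x y => adj G x y) (fun _ _ => 1%N)) /=.
  apply: eq_big => [x|x _]; first by rewrite inE.
  by rewrite sum1_card; apply: eq_card => y; rewrite !inE.
rewrite (partition_big (fun z => [set z.1; z.2]) (mem (edges G))) //=.
rewrite mulnC -sum_nat_const; apply: leq_sum => e eG.
have /eqP/cards2P [x [y [xy exy]]] := edge_card eG.
have pxy : (x, y) != (y, x) by rewrite xpair_eqE negb_and xy.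
rewrite (bigD1 (x, y)) /= ?/adj -?exy ?eG ?eqxx //.
by rewrite (bigD1 (y, x)) /= ?[[set y; x]]setUC -?exy ?eG ?eqxx // eq_sym.
Qed.

Lemma bigmin_nat_le (I : eqType) (r : seq I) (P : pred I) (F : I -> nat) n j :
  j \in r -> P j -> (\big[minn/n]_(i <- r | P i) F i <= F j)%N.
Proof.
elim: r => //= i r IH; rewrite inE big_cons => /orP[/eqP -> Pi|jr Pj].
  by rewrite Pi geq_minl.
case: ifP => _; last exact: IH.
by apply: leq_trans (geq_minr _ _) (IH jr Pj).
Qed.

Lemma bigmin_nat_le_id (I : Type) (r : seq I) (P : pred I) (F : I -> nat) n :
  (\big[minn/n]_(i <- r | P i) F i <= n)%N.
Proof.
elim/big_rec: _ => // i m _ le; exact: leq_trans (geq_minr _ _) le.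
Qed.

Lemma Qmin_le t n : (Qmin t n <= n)%N.
Proof. exact: bigmin_nat_le_id. Qed.

(** Pulling [G] back to [m] vertices of [U] does not raise the independence number, which stays
    below [Qmin t m]; so the pullback cannot be free of [t]-cliques. *)
Lemma Qmin_clique T (G : sgraph T) t m (U : {set T}) :
  (indep_num G < Qmin t m)%N -> (m <= #|U|)%N ->
  exists A : {set T}, [/\ A \subset U, #|A| = t & clique (adj G) A].
Proof.
move=> hG mU.
pose g (i : 'I_m) : T := enum_val (widen_ord mU i).
have g_inj : injective g.
  by move=> i j /enum_val_inj /(congr1 val) ij; apply: val_inj.
have gU i : g i \in U by exact: enum_valP.
pose ed := [set e : {set 'I_m} | (#|e| == 2%N) && (g @: e \in edges G)].
have edP : [forall e in ed, #|e| == 2%N].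
  by apply/forall_inP => e; rewrite inE => /andP[].
pose H := SGraph edP.
have adjH i j : adj H i j = adj G (g i) (g j).
  rewrite /adj inE imsetU1 imset_set1 cards2 andbC.
  case: (boolP (_ \in edges G)) => // /edge_card; rewrite cards2.
  by case: (i =P j) => // ->; rewrite eqxx.
have [/contains_completeP [A cA /cliqueP QA]|nK] := boolP (contains (complete t) H).
  exists (g @: A); split.
  - by apply/subsetP => _ /imsetP[i _ ->].
  - by rewrite card_imset.
  - apply/cliqueP => _ _ /imsetP[i iA ->] /imsetP[j jA ->] gij.
    by rewrite -adjH; apply: QA => //; apply: contra_neq gij => ->.
have : (indep_num H <= indep_num G)%N.
  apply/bigmax_leqP => B /forall_inP iB.
  rewrite -(card_imset _ g_inj).
  apply: (@leq_bigmax_cond _ _ (fun B : {set T} => #|B|)).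
  apply/forall_inP => _ /imsetP[i iB' ->]; apply/forall_inP => _ /imsetP[j jB ->].
  by rewrite -adjH; move/forall_inP: (iB i iB') => /(_ j jB).
have : (Qmin t m <= indep_num H)%N.
  by apply: bigmin_nat_le => //; rewrite mem_index_enum.
by move=> h1 h2; have := leq_ltn_trans h2 (leq_trans hG h1); rewrite ltnn.
Qed.

Lemma contains_complete_clique T (G : sgraph T) t (A : {set T}) :
  clique (adj G) A -> (t <= #|A|)%N -> contains (complete t) G.
Proof.
move=> /cliqueP QA tA; apply/contains_completeP.
pose g (i : 'I_t) : T := enum_val (widen_ord tA i).
have g_inj : injective g.
  by move=> i j /enum_val_inj /(congr1 val) ij; apply: val_inj.
exists (g @: setT); first by rewrite card_imset // cardsT card_ord.
apply/cliqueP => _ _ /imsetP[i _ ->] /imsetP[j _ ->]; apply: QA; exact: enum_valP.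
Qed.

Lemma dense_graph_clique_tuples (R : archiRealFieldType) (t k : nat) (eps : R) :
  (1 < t)%N -> (0 < k)%N -> 0 < eps ->
  exists mu c N0 : R, [/\ 0 < mu, 0 < c &
    forall T (G : sgraph T) (m : nat), N0 <= #|T|%:R -> m%:R <= mu * #|T|%:R ->
      (indep_num G < Qmin t m)%N -> ~~ contains (complete (2 * t)) G ->
      ((1 - t%:R^-1) * (1 - k%:R^-1) + eps) * #|T|%:R ^+ 2 <= (2 * #|edges G|)%:R ->
      c * #|T|%:R ^+ k.+1 <= (num_clique_tuples (adj G) k.+1 setT)%:R].
Proof.
move=> t1 k0 eps0.
have tgt1 : (1 : R) < t%:R by rewrite ltr1n.
have b01 : 0 < 1 - (t%:R^-1 : R) <= 1.
  by rewrite subr_gt0 gerBl invr_ge0 ler0n andbT invf_lt1 // (lt_trans _ tgt1).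
have [kap [c [N0 [kap0 c0 h]]]] := dense_clique_tuples k0 b01 eps0.
(* [local_density] requires a parameter of at most 1. *)
pose kap' := Num.min kap 1.
have k'0 : 0 < kap' by rewrite /kap' lt_min kap0 ltr01.
exists (kap' ^+ 2 / 2), c, N0; split => //; first by rewrite divr_gt0 ?exprn_gt0.
move=> T G m NT mT iG free hE.
apply: h => //.
- exact: adj_sym.
- move=> X Y.
  apply: (@le_trans _ _ ((1 - t%:R^-1) * (#|X|%:R * #|Y|%:R) + kap' * #|T|%:R ^+ 2)).
    apply: (@local_density _ _ _ t m) => //.
    + exact: ltnW.
    + exact: adj_sym.
    + exact: adj_irrefl.
    + by rewrite k'0 /kap' ge_min lexx orbT.
    + move=> A QA; apply: contra free => /eqP cA.
      by apply: contains_complete_clique QA _; rewrite cA.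
    + by move=> U; apply: Qmin_clique.
  by rewrite lerD2l ler_wpM2r ?sqr_ge0 // /kap' ge_min lexx.
- by apply: (le_trans hE); rewrite ler_nat sum_adj.
Qed.

End GraphCliques.

(** * Asymptotics *)

From mathcomp Require Import all_classical all_reals all_analysis.
Import numFieldNormedType.Exports.
Local Open Scope classical_set_scope.
Local Open Scope ring_scope.

Section Logarithms.
Variable R : realType.

Lemma powR2_log2 (n : nat) : (0 < n)%N -> 2 `^ (log2 n%:R) = n%:R :> R.
Proof.
move=> n0; rewrite /powR pnatr_eq0 /= /log2 divfK; last first.
  by rewrite lt0r_neq0 // ln_gt0 // ltr1n.
by rewrite lnK // posrE ltr0n.
Qed.

Lemma powR2_halve (a b d : R) : a <= b - 1 -> d <= b - 1 -> 2 `^ a <= 2 `^ b - 2 `^ d.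
Proof.
move=> ab db.
have two1 : (1 : R) <= 2 by rewrite ler1n.
have hb : 2 `^ b = 2 `^ (b - 1) + 2 `^ (b - 1) :> R.
  have {1}-> : b = (b - 1) + 1 by rewrite subrK.
  rewrite powRD ?pnatr_eq0 ?implybT // powRr1 //; ring.
have := ler_powR two1 ab; have := ler_powR two1 db.
rewrite hb; lra.
Qed.

(* With L the logarithm of the number of vertices, the i-th step of the
   iteration takes about L^(1-(i+1)/q) random samples and lowers the density
   from 2^-O(L^(i/q)) to 2^-O(L^((i+1)/q)). *)
Lemma random_choice_parameters (c : R) (p q : nat) : 0 < c -> (0 < q)%N ->
  exists K : R, forall (n : nat) (w : R), (1 < n)%N -> K <= w ->
    exists (eps : nat -> R) (s : nat -> nat), [/\ forall i, 0 < eps i, eps 0 <= c &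
      forall i, (i < q)%N ->
        n%:R * 2 `^ (- (w * log2 n%:R `^ (1 - q%:R^-1))) <=
          n%:R * eps i ^+ s i - n%:R ^+ p.+1 * eps i.+1 ^+ s i].
Proof.
move=> c0 q0.
have two1 : (1 : R) <= 2 by rewrite ler1n.
have two0 : (0 : R) <= 2 by [].
have ln2 : 0 < ln 2 :> R by rewrite ln_gt0 // ltr1n.
(* [C0] makes the initial density [2 ^ (- C0)] at most [c]. The increment [p + 1] of [C] per round
   pays for the factor [n ^ p] and a further factor 2. *)
pose C0 : R := Num.max 0 (- log2 c).
pose C i : R := C0 + p.+1%:R * i%:R.
have C00 : 0 <= C0 by rewrite /C0 le_max lexx.
have C_ge0 i : 0 <= C i by rewrite addr_ge0 // mulr_ge0.
exists (2 * C q + 1) => n w n1 wK.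
set L := log2 n%:R.
have L1 : 1 <= L.
  by rewrite /L /log2 ler_pdivlMr // mul1r ler_ln ?posrE ?ltr0n ?ler_nat // ltnW.
have L0 : 0 < L by apply: lt_le_trans L1.
have Lge1 x : 0 <= x -> 1 <= L `^ x.
  by move=> x0; apply: le_trans (ler_powR L1 x0); rewrite powRr0.
have Ln0 : L != 0 by rewrite lt0r_neq0.
have nE : 2 `^ L = n%:R :> R by rewrite powR2_log2 // ltnW.
have q0' : (0 : R) < q%:R by rewrite ltr0n.
pose e i : R := i%:R / q%:R.
(* At least [L ^ (1 - (i+1)/q)], and at most twice that because [L >= 1]. *)
pose s i := (Num.truncn (L `^ (1 - e i.+1))).+1.
pose lam i : R := C i * L `^ (e i).
exists (fun i => 2 `^ (- lam i)), s; split.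
- by move=> i; rewrite powR_gt0.
- rewrite /lam /e mul0r powRr0 mulr1 /C mulr0 addr0.
  apply: (@le_trans _ _ (2 `^ (log2 c))).
    apply: ler_powR => //; rewrite lerNl /C0 le_max lexx orbT //.
  by rewrite /powR pnatr_eq0 /= /log2 divfK ?lt0r_neq0 // lnK // posrE.
move=> i iq.
have sl : L `^ (1 - e i.+1) <= (s i)%:R by apply/ltW/truncnS_gt.
have ei1 : e i.+1 <= 1 by rewrite /e ler_pdivrMr // mul1r ler_nat.
have eS : e i.+1 = e i + q%:R^-1 by rewrite /e -natr1 mulrDl mul1r.
have su : (s i)%:R <= 2 * L `^ (1 - e i.+1).
  have p1 : 1 <= L `^ (1 - e i.+1) by apply: Lge1; rewrite subr_ge0.
  have : (Num.truncn (L `^ (1 - e i.+1)))%:R <= L `^ (1 - e i.+1).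
    by rewrite truncn_le powR_ge0.
  by rewrite /s -natr1; lra.
have powS j : (2 `^ (- lam j)) ^+ s i = 2 `^ (- (lam j * (s i)%:R)) :> R.
  by rewrite -powR_mulrn ?powR_ge0 // -powRrM mulNr.
rewrite !powS -{1 2 3}nE -powR_mulrn ?powR_ge0 // -powRrM.
rewrite -!powRD ?pnatr_eq0 ?implybT //.
have Lq1 : 1 <= L `^ (1 - q%:R^-1).
  by apply: Lge1; rewrite subr_ge0 invf_le1 // ler1n.
have h1 : lam i * (s i)%:R <= 2 * C q * L `^ (1 - q%:R^-1).
  have -> : L `^ (1 - q%:R^-1) = L `^ (e i) * L `^ (1 - e i.+1).
    by rewrite -powRD ?Ln0 ?implybT // eS; congr (_ `^ _); ring.
  have Ciq : C i <= C q by rewrite /C lerD2l ler_wpM2l // ler_nat ltnW.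
  have E0 : 0 <= L `^ e i by apply: powR_ge0.
  rewrite /lam; apply: (@le_trans _ _ (C q * L `^ e i * (2 * L `^ (1 - e i.+1)))).
    by rewrite ler_pM ?mulr_ge0 // ler_wpM2r.
  by rewrite le_eqVlt; apply/orP; left; apply/eqP; ring.
(* In exponents: the subtracted term is at most half of the main one, as [powR2_halve] requires. *)
have h2 : lam i * (s i)%:R + p%:R * L + 1 <= lam i.+1 * (s i)%:R.
  have hl : lam i + p.+1%:R * L `^ e i.+1 <= lam i.+1.
    have CS : C i.+1 = C i + p.+1%:R by rewrite /C -[i.+1%:R]natr1; ring.
    rewrite /lam CS [leRHS]mulrDl lerD2r.
    rewrite ler_wpM2l //; apply: ler_powR => //.
    by rewrite eS lerDl invr_ge0.
  have hL : L <= L `^ e i.+1 * (s i)%:R.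
    apply: (@le_trans _ _ (L `^ e i.+1 * L `^ (1 - e i.+1))).
      by rewrite -powRD ?Ln0 ?implybT // addrC subrK powRr1 // ltW.
    by rewrite ler_wpM2l // powR_ge0.
  have hp : p%:R * L + 1 <= p.+1%:R * (L `^ e i.+1 * (s i)%:R).
    rewrite -natr1 mulrDl mul1r lerD ?ler_wpM2l //.
    exact: le_trans L1 hL.
  have := ler_wpM2r (ler0n R (s i)) hl; rewrite mulrDl; lra.
apply: powR2_halve; last by rewrite -natr1; lra.
have : (2 * C q + 1) * L `^ (1 - q%:R^-1) <= w * L `^ (1 - q%:R^-1).
  by rewrite ler_wpM2r // powR_ge0.
lra.
Qed.

(** The limit superior is an infimum of suprema over neighbourhoods of infinity, and the set where
    [u n <= b + eps] is one of these. *)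
Lemma limn_esup_le (u : nat -> R) (b : R) :
  (forall eps, 0 < eps -> \forall n \near \oo, u n <= b + eps) ->
  (limn_esup (fun n => (u n)%:E) <= b%:E)%E.
Proof.
move=> h; apply/lee_addgt0Pr => eps eps0.
apply: ge_ereal_inf.
exists (ereal_sup ((fun n => (u n)%:E) @` [set n | u n <= b + eps]))%classic.
  by exists [set n | u n <= b + eps]%classic => //; apply: h.
by apply: ge_ereal_sup => _ /= [n hn <-]; rewrite -EFinD lee_fin.
Qed.
End Logarithms.

(** * The bound on the Ramsey-Turan density *)

Theorem theorem3p5 (R : realType) (p q t : nat) (omega : nat -> R)
    (hp : (2 <= p)%N) (hq : (2 <= q)%N) (ht : (2 <= t)%N)
    (homega : omega n @[n --> \oo] --> +oo)
    (htpq : (2 * t <= p * q)%N)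
    (hQ : \forall n \near \oo,
       (Qreal t (n%:R / omega n) <= Qreal p (f_bound q omega n))%N) :
  (rho_tau_sup R (complete (2 * t)) (fun n => Qreal t (n%:R / omega n))
   <= (2^-1 * (1 - t%:R^-1) * (1 - (q%:R - 1)^-1))%:E)%E.
Proof.
have p0 : (0 < p)%N by apply: ltnW.
have q1 : (0 < q.-1)%N by case: q hq {htpq hQ} => [|[]].
have qE : q = q.-1.+1 by rewrite prednK // ltnW.
have q1E : q%:R - 1 = q.-1%:R :> R by rewrite {1}qE -natr1 addrK.
rewrite q1E; apply: limn_esup_le => eps eps0.
have [mu [c [N0 [mu0 c0 hdense]]]] := dense_graph_clique_tuples ht q1 eps0.
have [K hK] := random_choice_parameters p c0 (ltnW hq).
have hw A : \forall n \near \oo, A <= omega n by move: A; apply/cvgryPge.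
near=> n.
have n1 : (1 < n)%N by near: n; exists 2%N.
have n0 : (0 : R) < n%:R by rewrite ltr0n ltnW.
have nN0 : N0 <= n%:R.
  near: n; exists (Num.truncn N0).+1 => // i /= hi.
  by apply: le_trans (ltW (truncnS_gt N0)) _; rewrite ler_nat.
(* Makes [n / omega n] at most [mu * n], the size at which every vertex set must contain a
   [t]-clique. *)
have wmu : mu^-1 <= omega n by near: n; apply: hw.
have wK : K <= omega n by near: n; apply: hw.
have hQn : (Qreal t (n%:R / omega n) <= Qreal p (f_bound q omega n))%N by near: n.
rewrite ler_pdivrMr ?exprn_gt0 //.
rewrite /RT; elim/big_ind: _ => [|a b ha hb|G /andP[free iG]].
(* The value 0 of an empty maximum is covered since the bound is nonnegative. *)
- rewrite mulr_ge0 ?sqr_ge0 // addr_ge0 ?(ltW eps0) //.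
  by rewrite !mulr_ge0 ?invr_ge0 // subr_ge0 invf_le1 ?ltr0n ?ler1n // ltnW // ltnW.
- by rewrite /maxn; case: ifP.
rewrite leNgt; apply/negP => many.
pose m := Num.truncn (n%:R / omega n).
pose m' := Num.truncn (f_bound q omega n).
have w0 : 0 < omega n by apply: lt_le_trans wmu; rewrite invr_gt0.
have mn : m%:R <= mu * n%:R.
  have : m%:R <= n%:R / omega n by rewrite truncn_le divr_ge0 // ltW.
  move=> /le_trans; apply; rewrite mulrC ler_wpM2r //.
  by rewrite -[mu]invrK lef_pV2 // posrE // invr_gt0.
(* The hypothesis comparing the two [Q] values enters here: every set of [m'] vertices contains a
   [p]-clique. *)
have iG' : (indep_num G < Qmin p m')%N by apply: leq_trans iG hQn.
have m'0 : (0 < m')%N by apply: leq_trans (Qmin_le p m'); apply: leq_ltn_trans iG'.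
have m'f : m'%:R <= f_bound q omega n.
  by rewrite truncn_le mulr_ge0 // powR_ge0.
have cliques : c * n%:R ^+ q.-1.+1 <= (num_clique_tuples (adj G) q.-1.+1 [set: 'I_n]%SET)%:R.
  have := hdense _ G m; rewrite card_ord; apply => //.
  have en0 : 0 <= eps * n%:R ^+ 2 by rewrite mulr_ge0 ?sqr_ge0 // ltW.
  by rewrite natrM; move: many en0; clear; lra.
rewrite -qE in cliques.
have [eps' [s [eps'0 eps'c hs]]] := hK n (omega n) n1 wK.
(* The iteration starts from all ordered [q]-cliques of [G] and ends with a clique on
   [q * p >= 2 * t] vertices. *)
have [|w||A [_ cA QA]] := @iterated_random_choice R _ (adj G) p m' q eps' s
  [set: 'I_n]%SET [set w | clique_tuple (adj G) [set: 'I_n]%SET w]%SET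
  (adj_sym G) (adj_irrefl G) p0 m'0 eps'0 (fun U => Qmin_clique iG').
- by move=> i iq; rewrite card_ord; apply: le_trans m'f (hs i iq).
- by rewrite inE.
- rewrite card_ord; apply: le_trans cliques.
  by rewrite ler_wpM2r // exprn_ge0.
move/negP: free; apply; apply: contains_complete_clique QA _.
by rewrite cA [(q * p)%N]mulnC.
Unshelve. all: by end_near.
Qed.
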